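(* Let $q$ be a prime power and let $t$ and $d$ be non-negative integers satisfying (i) $0\le t\le \sqrt{8d/9}-2$ if $q=2$, and (ii) $0\le t\le \sqrt{8d/5}-2$ if $q\ge 3$. Then every finite classical polar space of rank $d$ and order $q$ satisfies the following. (a) If $t$ is even, then the largest $(d,t)$-EKR set of generators is (up to isomorphism) the set of all generators that meet a fixed $d$-dimensional totally isotropic subspace (i.e. a fixed generator) in a subspace of dimension at least $d-\frac{t}{2}$. (b) If $t$ is odd, then the largest $(d,t)$-EKR set of generators is (up to isomorphism) the set of all generators that meet a fixed $(d-1)$-dimensional totally isotropic subspace in a subspace of dimension at least $d-\frac{t}{2}-\frac12$.
   Context: A finite classical polar space of rank $d$ and order $q$ is one of $Q^+(2d-1,q)$, $Q(2d,q)$, $Q^-(2d+1,q)$, $H(2d-1,q)$, $H(2d,q)$ (for $q$ a square), $W(2d-1,q)$: the totally isotropic (for quadrics: totally singular) subspaces of a non-degenerate sesquilinear or quadratic form on a vector space over $\mathbb{F}_q$. All dimensions are vector space dimensions. The generators are the maximal totally isotropic subspaces; they all have dimension $d$ (the rank). A $(d,t)$-EKR set is a set $Y$ of generators such that any $y_1,y_2\in Y$ satisfy $d-\dim(y_1\cap y_2)\le t$. *)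

(* Defs.v *)
From HB Require Import structures.
From mathcomp Require Import all_boot all_order all_algebra.

Set Implicit Arguments.
Unset Strict Implicit.
Unset Printing Implicit Defensive.

Import GRing.Theory VectorInternalTheory.
Local Open Scope ring_scope.

(* A vector space over a finite field has finitely many subspaces; this makes
   {set {vspace V}} and cardinals of families of subspaces available. *)
HB.instance Definition _ (F : finFieldType) (V : vectType F) :=
  [Countable of {vspace V} by <:].
HB.instance Definition _ (F : finFieldType) (V : vectType F) :=
  [Finite of {vspace V} by <:].

Section QuadraticForms.
Variables (F : fieldType) (V : vectType F) (Q : V -> F).

Definition polar_form (u v : V) : F := Q (u + v) - Q u - Q v.

Definition quadratic_form : Prop :=
  (forall (a : F) (v : V), Q (a *: v) = a ^+ 2 * Q v) /\
  bilinear_for *%R *%R polar_form.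

(* In characteristic 2 the polar form of a non-degenerate quadratic form on an
   odd-dimensional space has a 1-dimensional radical; only the absence of
   nonzero singular vectors in the radical is required. *)
Definition nondegenerate_quadratic : Prop :=
  forall v : V, Q v = 0 -> (forall u : V, polar_form u v = 0) -> v = 0.

End QuadraticForms.

Section PolarSpaces.
Variables (F : finFieldType) (V : vectType F).
Implicit Types (P Y Z : {set {vspace V}}) (U W : {vspace V}) (d t k : nat).

(* A polar space is represented by the set P of its totally isotropic (totally
   singular) subspaces.  The types W(2d-1,q); H(2d-1,q), H(2d,q); and
   Q^+(2d-1,q), Q(2d,q), Q^-(2d+1,q) correspond to the three constructors, the
   individual type being determined by \dim {:V} and the rank.
   is_psymplectic, is_unitary include non-degeneracy, and is_psymplectic also
   requires the form to be alternating in characteristic 2. *)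
Variant classical_polar_space P : Prop :=
| SymplecticPolarSpace (f : {skew_symmetric V}) of
    is_psymplectic f &
    (forall U, (U \in P) = (U <= orthov f U)%VS)
| HermitianPolarSpace (theta : involutive_rmorphism F)
    (f : {hermitian_sym V for theta}) of
    ~ (theta =1 id) &
    is_unitary f &
    (forall U, (U \in P) = (U <= orthov f U)%VS)
| OrthogonalPolarSpace (Q : V -> F) of
    quadratic_form Q &
    nondegenerate_quadratic Q &
    (forall U, U \in P <-> {in U, forall u, Q u = 0}).

Definition polar_rank P : nat := \max_(U in P) \dim U.

Definition generators P : {set {vspace V}} :=
  [set U in P | [forall W in P, (U <= W)%VS ==> (W == U)]].

Definition EKR_set P d t Y : Prop :=
  Y \subset generators P /\
  {in Y &, forall y1 y2, (d - \dim (y1 :&: y2)%VS <= t)%N}.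

Definition largest_EKR_set P d t Y : Prop :=
  EKR_set P d t Y /\ forall Z, EKR_set P d t Z -> (#|Z| <= #|Y|)%N.

Definition generators_meeting P U k : {set {vspace V}} :=
  [set g in generators P | (k <= \dim (g :&: U)%VS)%N].

Definition polar_automorphism P (phi : {vspace V} -> {vspace V}) : Prop :=
  phi @: P = P /\ {in P &, forall U W, (phi U <= phi W)%VS = (U <= W)%VS}.

Definition isomorphic_in P Y Z : Prop :=
  exists phi : {vspace V} -> {vspace V},
    polar_automorphism P phi /\ phi @: Y = Z.

End PolarSpaces.

(* Main.v *)
Require Import Defs.
From HB Require Import structures.
From mathcomp Require Import all_boot all_order all_algebra.
From mathcomp Require Import zify ring.

(** Let [d] be the rank and [s = t./2].  Three generators satisfy
    [dim (U :&: y) + dim (z :&: U) + dim (z :&: y) <= d + 2 dim (z :&: U :&: y)],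
    because [U :&: y + z :&: U + z :&: y] is totally isotropic.  If [y1], [y2] are
    members of an EKR set [Y] at distance exactly [t], this shows that each
    member of [Y] meets [A = y1 :&: y2] in codimension at most [s].  The members
    meeting [A] in smaller codimension are few (a factor [q ^ d] is lost); any
    other member [z] is close to the generator [X + (y2 :&: perp X)] where
    [X = A + (z :&: y1)], and there are at most [q ^ O(t ^ 2)] such generators
    [U].  If some [y] in [Y] is far from [U], the inequality for [U], [y], [z]
    forces [z] to meet [U :&: y] in codimension less than [s], and again few [z]
    remain.  So either [Y] is small or all of [Y] is close to one generator [g].
    For even [t] this is the example; for odd [t] the traces on [g] of the
    members of [Y] that are farthest from [g] are, in the dual of [g], an
    intersecting family, and a Hilton-Milner type count shows that they lie in a
    hyperplane of [g].

    The examples are equivalent because the isometry group is transitive on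
    totally isotropic subspaces of given dimension: adjacent subspaces are
    exchanged by a transvection or a reflection. *)

(** Every count is compared with the leading term of the example, [q ^ (s * (d - s)) * opp_count s]
    for $t=2s$ and [q ^ (s * (d - s.+1)) * opp_count s.+1] for $t=2s+1$; an error term is harmless
    once its exponent of [q] is smaller by [kp]. The type of the polar space enters the counting
    only through [E], one less than the number of generators on a member of [P] of dimension $d-1$,
    and of [E] only [0 < E <= q ^ 3] is used. The bound on [t] makes [d] outgrow the exponents
    quadratic in [s] that come from the number of choices of [X] and from the quotient of
    [opp_count t] by the [opp_count] of the example. The obstacle for odd [t] is that [X] has
    dimension only $d-s-1$: the exponent of the resulting estimate starts from $s+1$, that of the
    example from $s$, so one saving of order [d] is not enough. *)

Set Implicit Arguments.
Unset Strict Implicit.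
Unset Printing Implicit Defensive.

Import Order.TTheory GRing.Theory Num.Theory.

Ltac dlia := intros; repeat match goal with
  | H : is_true (leq _ _) |- _ => revert H
  | H : is_true (andb (leq _ _) (leq _ _)) |- _ => revert H
  | H : @eq ?T _ _ |- _ => unify T nat; revert H
  end; clear; lia.

(** * Gaussian binomial coefficients *)

(* [gbin q n a] counts the subspaces of codimension [a] in dimension [n]. *)
Fixpoint gbin (q n a : nat) : nat :=
  match n, a with
  | _, 0 => 1
  | 0, _.+1 => 0
  | n'.+1, a'.+1 => gbin q n' a' + q ^ a * gbin q n' a
  end.

Lemma gbin0 q n : gbin q n 0 = 1. Proof. by case: n. Qed.

Lemma gbinS q n a :
  gbin q n.+1 a.+1 = (gbin q n a + q ^ a.+1 * gbin q n a.+1).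
Proof. by []. Qed.

Lemma gbin_small q n a : (n < a) -> gbin q n a = 0.
Proof.
elim: n a => [|n IH] [|a] //= lt_na.
by rewrite !IH ?muln0 //; lia.
Qed.

Section GaussianBounds.
Variable q : nat.
Hypothesis q_gt1 : 1 < q.

(** The ratio of consecutive Gaussian coefficients, $(q^{a+1}-1)[n,a+1]=(q^{n-a}-1)[n,a]$, arranged
    to avoid truncated subtraction. *)
Lemma gbin_shift n a : a <= n ->
  gbin q n a.+1 * q ^ a.+1 + gbin q n a = gbin q n a * q ^ (n - a) + gbin q n a.+1.
Proof.
elim: n a => [|n IH] [|a] //=.
  by move=> _; move: (IH 0 isT); rewrite gbin0 subn0 /= !expnS expn0; lia.
rewrite ltnS leq_eqVlt => /orP[/eqP ->|lt_an].
  have := IH n (leqnn n); rewrite subnn subSS subnn [gbin q n n.+2]gbin_small //.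
  by rewrite [gbin q n n.+1]gbin_small //; lia.
have e1 := IH a (ltnW lt_an); have e2 := congr1 (muln (q ^ a.+2)) (IH a.+1 lt_an).
rewrite subSS; have E : n - a = (n - a.+1).+1 by lia.
move: e1 e2; rewrite E !expnS; lia.
Qed.

Lemma gbin_lb n a : a <= n -> q ^ (a * (n - a)) <= gbin q n a.
Proof.
elim: n a => [|n IH] [|a] //; rewrite ?gbin0 // ltnS leq_eqVlt.
case/orP=> [/eqP -> |lt_an].
  by rewrite subSS subnn muln0 gbinS; have := IH n (leqnn n); rewrite subnn muln0; lia.
rewrite gbinS; apply: leq_trans (leq_addl _ _).
have -> : a.+1 * (n.+1 - a.+1) = a.+1 + a.+1 * (n - a.+1).
  by rewrite subSS -mulnS; congr (_ * _); lia.
by rewrite expnD leq_mul2l IH ?orbT.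
Qed.

Definition qfact a := \prod_(i < a) (q ^ i.+1 - 1).

Lemma qfactS a : qfact a.+1 = qfact a * (q ^ a.+1 - 1).
Proof. by rewrite /qfact big_ord_recr. Qed.

(** A bound for the infinite product of the $1/(1-q^{-i})$, which is about 3.46 for $q=2$ and below
    1.79 for $q\ge 3$. *)
Definition qconst := if q == 2 then 4 else 2.

Lemma exp_leq_qfact a : q ^ 'C(a.+1, 2) <= qconst * qfact a.
Proof.
rewrite /qconst; case: eqVneq => [q2|qn2].
  case: a => [|a]; first by rewrite /qfact big_ord0 bin_small.
  (* With $n=a+1$ this says $4\prod_{i\le n}(1-2^{-i})\ge 1+2^{1-n}$, an equality at $n=1$; without
     the last term the induction would not close. *)
  have : q ^ 'C(a.+2, 2) + q * q ^ 'C(a.+1, 2) <= 4 * qfact a.+1.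
    elim: a => [|a IH]; first by rewrite /qfact big_ord1 q2.
    rewrite qfactS mulnA; apply: leq_trans (leq_mul IH (leqnn (q ^ a.+2 - 1))).
    have -> : q ^ 'C(a.+3, 2) = q ^ 'C(a.+1, 2) * q ^ a.+1 * (q * q ^ a.+1).
      by rewrite binS bin1 expnD binS bin1 expnD -expnS.
    have -> : q ^ 'C(a.+2, 2) = q ^ 'C(a.+1, 2) * q ^ a.+1 by rewrite binS bin1 expnD.
    have : 2 <= q ^ a.+1 by rewrite expnS q2 leq_pmulr ?expn_gt0.
    rewrite [q ^ a.+2]expnS q2; move: (2 ^ a.+1) (2 ^ 'C(a.+1, 2)) => A B.
    by rewrite mulnBr muln1 => A2; nia.
  by apply: leq_trans; apply: leq_addr.
have q3 : 3 <= q by lia.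
(* The same strengthening: $2\prod_{i\le a}(1-q^{-i})\ge 1+q^{-a}$. *)
have : q ^ 'C(a.+1, 2) + q ^ 'C(a, 2) <= 2 * qfact a.
  elim: a => [|a IH]; first by rewrite /qfact big_ord0 bin_small // bin_small.
  rewrite qfactS mulnA; apply: leq_trans (leq_mul IH (leqnn (q ^ a.+1 - 1))).
  have -> : q ^ 'C(a.+2, 2) = q ^ 'C(a, 2) * q ^ a * q ^ a.+1.
    by rewrite binS bin1 expnD binS bin1 expnD.
  have -> : q ^ 'C(a.+1, 2) = q ^ 'C(a, 2) * q ^ a by rewrite binS bin1 expnD.
  have g : 0 < q ^ 'C(a,2) by rewrite expn_gt0; lia.
  have g2 : 0 < q ^ a by rewrite expn_gt0; lia.
  rewrite expnS; move: (q ^ a) (q ^ 'C(a, 2)) g g2 => A B g g2.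
  have h : 3 * A <= q * A by rewrite leq_mul2r q3 orbT.
  move: (q * A) h => C h.
  have h2 : B * (2 * A + 1) <= B * C by rewrite leq_mul2l; lia.
  by rewrite mulnBr muln1; nia.
by apply: leq_trans; apply: leq_addr.
Qed.

(** The left-hand side is $\prod_{i<a}(q^n-q^i)$, the number of linearly independent $a$-tuples in
    dimension $n$. *)
Lemma gbin_qfact n a : a <= n -> gbin q n a * qfact a * q ^ 'C(a, 2) <= q ^ (n * a).
Proof.
elim: a => [|a IH] le_an; first by rewrite gbin0 /qfact big_ord0 muln0.
have := IH (ltnW le_an); have := gbin_shift (ltnW le_an).
have e : q ^ (n * a.+1) = q ^ (n * a) * q ^ a * q ^ (n - a).
  by rewrite -!expnD; congr (_ ^ _); rewrite mulnS; lia.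
rewrite qfactS [in 'C(a.+1, 2)]binS bin1 expnD e.
set g := gbin q n a; set g' := gbin q n a.+1 => sh le1.
have ->: g' * (qfact a * (q ^ a.+1 - 1)) = g * (q ^ (n - a) - 1) * qfact a.
  by rewrite mulnCA mulnC; congr (_ * _); rewrite !mulnBr !muln1; lia.
have h : q ^ (n - a) - 1 <= q ^ (n - a) by lia.
have := leq_mul (leq_mul le1 (leqnn (q ^ a))) h.
by apply: leq_trans; apply: eq_leq; nia.
Qed.

Lemma gbin_ub n a : a <= n -> gbin q n a <= qconst * q ^ (a * (n - a)).
Proof.
move=> le_an; have g : 0 < q ^ (a * a) by rewrite expn_gt0; lia.
rewrite -(leq_pmul2r g) -mulnA -expnD -mulnDr subnK // [a * n]mulnC.
apply: leq_trans (leq_mul (leqnn qconst) (gbin_qfact le_an)).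
have -> : a * a = 'C(a.+1, 2) + 'C(a, 2).
  by elim: a {le_an g} => [|a IH] //; rewrite !binS !bin1 bin0 in IH *; lia.
rewrite expnD; have := leq_mul (leqnn (gbin q n a * q ^ 'C(a, 2))) (exp_leq_qfact a).
by move=> h; apply: leq_trans (leq_trans h _); apply: eq_leq; nia.
Qed.

(** The number of generators in rank [n] when each member of dimension $n-1$ lies on $E+1$ of
    them. *)
Definition gen_count E n := \prod_(i < n) (1 + q ^ i * E).

Lemma gen_countS E n : gen_count E n.+1 = gen_count E n * (1 + q ^ n * E).
Proof. by rewrite /gen_count big_ord_recr. Qed.

(** The factor for $i=0$ is at most $2E$; for $i>0$, $1+q^iE\le q^iE/(1-q^{-i})$, so [exp_leq_qfact]
    bounds the rest. *)
Lemma gen_count_ub E n : 0 < E ->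
  gen_count E n <= 2 * qconst * (q ^ 'C(n, 2) * E ^ n).
Proof.
move=> E0; have c2 : 2 <= qconst by rewrite /qconst; case: ifP.
case: n => [|n]; first by rewrite /gen_count big_ord0 expn0; lia.
have h : gen_count E n.+1 * qfact n <= 2 * (q ^ 'C(n.+1, 2) * q ^ 'C(n.+1, 2)) * E ^ n.+1.
  elim: n => [|n IH]; first by rewrite /gen_count /qfact big_ord0 big_ord1 expn0 expn1; nia.
  rewrite gen_countS qfactS [in 'C(n.+2, 2)]binS bin1 expnD [E ^ n.+2]expnS.
  have h : (1 + q ^ n.+1 * E) * (q ^ n.+1 - 1) <= q ^ n.+1 * q ^ n.+1 * E.
    have : 0 < q ^ n.+1 by rewrite expn_gt0; lia.
    by move: (q ^ n.+1) => A ?; nia.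
  rewrite mulnACA; apply: leq_trans (leq_mul IH h) _.
  by rewrite [E ^ n.+1]expnS; apply: eq_leq; nia.
have g : 0 < q ^ 'C(n.+1, 2) by rewrite expn_gt0; lia.
rewrite -(leq_pmul2r g).
have h2 := leq_mul (leqnn (gen_count E n.+1)) (exp_leq_qfact n).
apply: leq_trans h2 _; rewrite mulnCA.
apply: leq_trans (leq_mul (leqnn qconst) h) _.
by apply: eq_leq; nia.
Qed.

End GaussianBounds.

Local Open Scope ring_scope.

(** * Counting subspaces *)

Lemma card_fibers (aT rT : finType) (A : {set aT}) (B : {set rT})
    (f : aT -> rT) (c : nat) :
  {in A, forall a, f a \in B} ->
  {in B, forall b, #|[set a in A | f a == b]| = c} -> #|A| = (#|B| * c)%N.
Proof.
move=> fAB fibE; rewrite -sum1_card (partition_big f [in B]) //=.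
rewrite -sum_nat_const; apply: eq_bigr => b /fibE <-.
by rewrite -sum1_card; apply: eq_bigl => a; rewrite inE.
Qed.

Lemma card_cover_leq (aT rT : finType) (A : {set aT}) (B : {set rT})
    (C : rT -> {set aT}) (c : nat) :
  {in A, forall a, exists2 b, b \in B & a \in C b} ->
  {in B, forall b, (#|C b| <= c)%N} -> (#|A| <= #|B| * c)%N.
Proof.
move=> covA leC.
have sAC : A \subset \bigcup_(b in B) C b.
  by apply/subsetP=> a /covA[b bB aC]; apply/bigcupP; exists b.
apply: leq_trans (subset_leq_card sAC) _.
rewrite -sum_nat_const; apply: (@leq_trans (\sum_(b in B) #|C b|)); last first.
  by apply: leq_sum => b /leC.
elim/big_rec2: _ => [|b m S _ le_m]; first by rewrite cards0.
by apply: leq_trans (leq_card_setU _ _) _; rewrite leq_add2l.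
Qed.

Section Subspaces.
Variables (F : fieldType) (V : vectType F).
Implicit Types (U W X T H S : {vspace V}) (x v : V).

Lemma dimv_add_line U x : x \notin U -> \dim (U + <[x]>) = (\dim U).+1.
Proof.
move=> xU; have x0 : x != 0 by apply: contraNneq xU => ->; rewrite mem0v.
rewrite dimv_disjoint_sum ?dim_vline ?x0 ?addn1 //.
apply/eqP; rewrite -subv0; apply/subvP=> v /memv_capP[vU /vlineP[a va]].
rewrite memv0; case: (eqVneq a 0) va => [->|a0 va]; first by rewrite scale0r => ->.
by move: xU; rewrite -(scalerK a0 x) -va rpredZ.
Qed.

Lemma subv_between W T m : (W <= T)%VS -> (\dim W <= m <= \dim T)%N ->
  exists X, [/\ (W <= X)%VS, (X <= T)%VS & \dim X = m].
Proof.
move=> sWT /andP[leWm lemT]; move En: (m - \dim W)%N => n.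
elim: n W sWT leWm En => [|n IH] W sWT leWm En.
  by exists W; split=> //; apply/eqP; rewrite eqn_leq leWm -subn_eq0 En.
have /subvPn[x xT xW] : ~~ (T <= W)%VS.
  by apply/negP=> /dimvS; lia.
have dimWx := dimv_add_line xW.
have [|||X [sX1 sX2 dX]] := IH (W + <[x]>)%VS.
- by rewrite subv_add sWT -memvE.
- by rewrite dimWx; lia.
- by rewrite dimWx; lia.
by exists X; split=> //; apply: subv_trans sX1; apply: addvSl.
Qed.

Lemma subv_dim_eq U W : (U <= W)%VS -> (\dim W <= \dim U)%N -> U = W.
Proof. by move=> sUW le; apply/eqP; rewrite eqEdim sUW. Qed.

End Subspaces.

Section SubspaceCounting.
Variables (F : finFieldType) (V : vectType F).
Implicit Types (U W X T H S : {vspace V}) (x v : V).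
Local Notation q := #|F|.

Definition intervalv W T m : {set {vspace V}} :=
  [set X | [&& (W <= X)%VS, (X <= T)%VS & \dim X == m]].

Lemma intervalvP W T m X :
  reflect [/\ (W <= X)%VS, (X <= T)%VS & \dim X = m] (X \in intervalv W T m).
Proof.
by rewrite inE; apply: (iffP and3P) => [[-> -> /eqP]|[-> -> ->]].
Qed.

Definition vec_of (C : {vspace V}) (r : 'rV[F]_(\dim C)) : V :=
  \sum_i r 0 i *: (vbasis C)`_i.

Lemma vec_of_mem C (r : 'rV_(\dim C)) : vec_of r \in C.
Proof.
by apply: rpred_sum => i _; rewrite rpredZ // vbasis_mem ?mem_nth ?size_tuple.
Qed.

Lemma vec_of_surj (C : {vspace V}) v :
  v \in C -> exists r : 'rV_(\dim C), vec_of r = v.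
Proof.
move=> vC; exists (\row_i coord (vbasis C) i v).
by rewrite [RHS](coord_vbasis vC); apply: eq_bigr => i _; rewrite mxE.
Qed.

Lemma vec_of_inj C : injective (@vec_of C).
Proof.
move=> r r' eq_rr'; apply/rowP=> i.
have fr := basis_free (vbasisP C).
by rewrite -(coord_sum_free (r 0) i fr) -(coord_sum_free (r' 0) i fr) [X in coord _ _ X]eq_rr'.
Qed.

Lemma card_rV n : #|{: 'rV[F]_n}| = (q ^ n)%N.
Proof. by rewrite card_mx mul1n. Qed.

(** Each such [X] is [S + <[v0 + c]>] for exactly one [c] in a complement of [S] in [H], where [v0]
    is a fixed vector of [T] outside [H]. *)
Lemma card_line_extensions H T S :
    (H <= T)%VS -> \dim T = (\dim H).+1 -> (S <= H)%VS ->
  #|[set X in intervalv S T (\dim S).+1 | ~~ (X <= H)%VS]| =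
    (q ^ (\dim H - \dim S))%N.
Proof.
move=> sHT dT sSH.
have /subvPn[v0 v0T v0H] : ~~ (T <= H)%VS by apply/negP=> /dimvS; lia.
pose C := (H :\: S)%VS.
have SC : (C + S)%VS = H by rewrite addv_diff; apply/addv_idPl.
have CS0 : (C :&: S)%VS = 0%VS by rewrite capv_diff.
have sCH : (C <= H)%VS by rewrite -SC addvSl.
have dC : (\dim H - \dim S)%N = \dim C.
  by rewrite -SC dimv_disjoint_sum ?addnK.
have TE : (H + <[v0]>)%VS = T.
  by apply: subv_dim_eq; rewrite ?dimv_add_line ?dT // subv_add sHT -memvE.
have vH (r : 'rV[F]_(\dim C)) : vec_of r \in H.
  by rewrite (subvP sCH) ?vec_of_mem.
have wH (r : 'rV[F]_(\dim C)) : v0 + vec_of r \notin H.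
  by rewrite rpredDr.
pose phi (r : 'rV[F]_(\dim C)) := (S + <[v0 + vec_of r]>)%VS.
rewrite dC -card_rV -(card_imset (f := phi)); last first.
  move=> r r' eq_phi; apply: vec_of_inj; apply/eqP; rewrite -subr_eq0 -memv0 -CS0.
  have : v0 + vec_of r' \in phi r by rewrite eq_phi memvE addvSr.
  case/memv_addP=> u uS [_ /vlineP[a ->]] eq_u.
  have a1 : a = 1.
    apply/eqP; rewrite eq_sym -subr_eq0; apply: contraNT v0H => a1.
    rewrite -(scalerK a1 v0) rpredZ //.
    have -> : (1 - a) *: v0 = u + a *: vec_of r - vec_of r'.
      apply/eqP; rewrite scalerBl scale1r subr_eq addrAC -subr_eq opprK eq_u.
      by rewrite scalerDr addrA addrAC.
    by rewrite rpredB ?rpredD ?rpredZ ?vH // (subvP sSH).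
  rewrite a1 scale1r addrCA in eq_u; move/addrI in eq_u.
  by rewrite memv_cap rpredB ?vec_of_mem //= eq_u opprD addrA addrAC subrr add0r rpredN.
apply: eq_card => X; rewrite inE; apply/andP/imsetP=> [[/intervalvP[sSX sXT dX]]|[r _ ->]].
  case/subvPn=> x xX xH.
  have : x \in (H + <[v0]>)%VS by rewrite TE (subvP sXT).
  case/memv_addP=> h hH [_ /vlineP[a ->] xE].
  have a0 : a != 0 by apply: contraNneq xH => a0; rewrite xE a0 scale0r addr0.
  have : a^-1 *: h \in (C + S)%VS by rewrite SC rpredZ.
  case/memv_addP=> c cC [s sS hE].
  have [r rE] := vec_of_surj cC; exists r => //; apply/esym.
  apply: subv_dim_eq; last first.
    by rewrite dX dimv_add_line //; apply: contra (wH r); apply: subvP.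
  rewrite subv_add sSX -memvE rE.
  have -> : v0 + c = a^-1 *: x - s.
    by rewrite xE scalerDr scalerK // hE addrAC addrK addrC.
  by rewrite rpredB ?rpredZ // (subvP sSX).
have wrT : v0 + vec_of r \in T by rewrite rpredD // (subvP sHT).
split; last first.
  by apply: contra (wH r) => /subvP; apply; rewrite memvE addvSr.
apply/intervalvP; split; first exact: addvSl.
  by rewrite subv_add (subv_trans sSH) // -memvE.
by rewrite dimv_add_line //; apply: contra (wH r); apply: subvP.
Qed.

(** Pascal's rule for a hyperplane [H] of [T] on [W]: the members inside [H] give the first summand,
    the others are sorted by their trace on [H]. *)
Lemma card_intervalv W T m : (W <= T)%VS -> (m <= \dim T)%N ->
  #|intervalv W T m| = gbin q (\dim T - \dim W) (\dim T - m).
Proof.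
move En: (\dim T - \dim W)%N => n; elim: n T m En => [|n IH] T m En sWT lemT.
  have WT : W = T by apply: subv_dim_eq; lia.
  have [eq_m|neq_m] := eqVneq m (\dim T).
    rewrite eq_m subnn gbin0 (_ : intervalv _ _ _ = [set T]) ?cards1 //.
    apply/setP=> X; rewrite [in RHS]inE; apply/intervalvP/eqP => [[? ? ?]| ->].
      by apply: subv_dim_eq => //; lia.
    by rewrite WT.
  rewrite gbin_small; last by lia.
  apply: eq_card0 => X; apply/negbTE/negP => /intervalvP[/dimvS leWX /dimvS leXT dX].
  by rewrite WT in leWX; move/eqP: neq_m; lia.
case Ea: (\dim T - m)%N => [|a].
  have eq_m : m = \dim T by lia.
  rewrite gbin0 eq_m (_ : intervalv _ _ _ = [set T]) ?cards1 //.
  apply/setP=> X; rewrite [in RHS]inE; apply/intervalvP/eqP => [[? ? ?]| ->] //.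
  by apply: subv_dim_eq => //; lia.
have [||H [sWH sHT dH]] := @subv_between _ _ W T (\dim T).-1 => //; first by lia.
have EH : \dim T = (\dim H).+1 by lia.
rewrite -(cardsID [set X | (X <= H)%VS]) gbinS; congr (_ + _)%N.
  have <- : (\dim H - m)%N = a by lia.
  rewrite -IH //; try lia.
  apply: eq_card => X; rewrite !inE; apply/idP/idP.
    by case/andP=> /and3P[-> _ ->] ->.
  by case/and3P=> -> sXH ->; rewrite sXH (subv_trans sXH).
case: m lemT Ea => [|m] lemT Ea.
  rewrite gbin_small ?muln0; last by lia.
  apply: eq_card0 => X; rewrite !inE; apply/negbTE/negP => /andP[nXH /and3P[_ _]].
  by rewrite dimv_eq0 => /eqP X0; rewrite X0 sub0v in nXH.
have sXT_dim X : (X <= T)%VS -> ~~ (X <= H)%VS -> \dim X = (\dim (X :&: H)).+1.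
  move=> sXT /subvPn[x xX xH].
  have XHT : (X + H)%VS = T.
    apply: subv_dim_eq; first by rewrite subv_add sXT.
    by rewrite EH -(dimv_add_line xH) dimvS // addvC addvS // -memvE.
  by have := dimv_sum_cap X H; rewrite XHT; lia.
have -> : gbin q n a.+1 = #|intervalv W H m|.
  by rewrite IH //; first (congr (gbin _ _ _); lia); lia.
rewrite mulnC.
apply: (@card_fibers _ _ _ _ (fun X => (X :&: H)%VS)) => [X|S].
  rewrite !inE => /andP[nXH /and3P[sWX sXT /eqP dX]].
  by rewrite subv_cap sWX sWH capvSr /=; have := sXT_dim _ sXT nXH; lia.
case/intervalvP=> sWS sSH dS.
have -> : a.+1 = (\dim H - \dim S)%N by lia.
rewrite -(card_line_extensions sHT EH sSH).
apply: eq_card => X; rewrite !inE; apply/idP/idP.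
  case/andP=> /andP[nXH /and3P[sWX sXT /eqP dX]] /eqP XS.
  by rewrite -{1}XS capvSl sXT nXH dX dS eqxx.
case/andP=> /and3P[sSX sXT /eqP dX] nXH; rewrite nXH sXT dX dS eqxx (subv_trans sWS sSX) /=.
rewrite eq_sym eqEdim subv_cap sSX sSH /=.
by have := sXT_dim _ sXT nXH; lia.
Qed.

End SubspaceCounting.

(** * Polar geometries *)

(** What the counting uses of an orthogonality relation. [perp] is not assumed involutive, so that
    quadrics in characteristic 2, whose polar form may be degenerate, are covered. *)
Record polar_geometry (F : finFieldType) (V : vectType F)
    (P : {set {vspace V}}) (perp : {vspace V} -> {vspace V}) : Prop :=
  PolarGeometry {
    polar0 : 0%VS \in P;
    polarS : forall U W, W \in P -> (U <= W)%VS -> U \in P;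
    perpC : forall U W, (U <= perp W)%VS = (W <= perp U)%VS;
    sub_perp : forall U, U \in P -> (U <= perp U)%VS;
    polarD : forall U W, U \in P -> W \in P -> (U <= perp W)%VS -> (U + W)%VS \in P;
    dim_cap_perp : forall U W, (\dim W <= \dim (W :&: perp U) + \dim U)%N }.

Section PolarGeometry.
Variables (F : finFieldType) (V : vectType F).
Variables (P : {set {vspace V}}) (perp : {vspace V} -> {vspace V}).
Hypothesis PG : polar_geometry P perp.
Implicit Types (U W X y z g H K : {vspace V}).
Local Notation q := #|F|.
Local Notation d := (polar_rank P).
Local Notation gens := (generators P).

Let q_gt1 : (1 < q)%N. Proof. exact: card_finNzRing_gt1. Qed.

Lemma perpS U W : (U <= W)%VS -> (perp W <= perp U)%VS.
Proof. by move=> sUW; rewrite (perpC PG) (subv_trans sUW) // -(perpC PG). Qed.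

Lemma polar_sub_perp U X Y : U \in P -> (X <= U)%VS -> (Y <= U)%VS -> (X <= perp Y)%VS.
Proof.
move=> UP sXU sYU; apply: subv_trans sXU (subv_trans (sub_perp PG UP) _).
exact: perpS.
Qed.

Lemma polar_dim_leq U : U \in P -> (\dim U <= d)%N.
Proof. by move=> UP; apply: (leq_bigmax_cond (F := fun U : {vspace V} => \dim U)). Qed.

Lemma cap_perp_max W U : U \in gens -> W \in P -> (W :&: perp U <= U)%VS.
Proof.
rewrite inE => /andP[UP /forall_inP maxU] WP.
have sP : (U + (W :&: perp U))%VS \in P.
  apply: (polarD PG) => //; first by apply: (polarS PG) WP _; apply: capvSl.
  by rewrite (perpC PG) capvSr.
have /implyP/(_ (addvSl _ _))/eqP eU := maxU _ sP.
by have := addvSr U (W :&: perp U); rewrite eU.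
Qed.

(* A codimension bound that exploits that [X :&: y] is orthogonal to [y]. *)
Lemma dim_cap_perp_geq X y : y \in P ->
  (\dim y + \dim (X :&: y) <= \dim (y :&: perp X) + \dim X)%N.
Proof.
move=> yP; pose C := (X :\: y)%VS.
have XE : (C + (X :&: y))%VS = X by apply: addv_diff_cap.
have dX : (\dim C + \dim (X :&: y) = \dim X)%N.
  rewrite -dimv_disjoint_sum ?XE //.
  apply/eqP; rewrite -subv0; have := capv_diff X y; rewrite -/C => <-.
  by rewrite subv_cap capvSl (subv_trans (capvSr _ _)) ?capvSr.
have s : (y :&: perp C <= y :&: perp X)%VS.
  rewrite subv_cap capvSl (perpC PG) /=.
  suff : (C + (X :&: y) <= perp (y :&: perp C))%VS by rewrite XE.
  rewrite subv_add; apply/andP; split.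
    by rewrite (perpC PG) capvSr.
  by apply: (polar_sub_perp yP); rewrite ?capvSr ?capvSl.
by have := dim_cap_perp PG C y; have := dimvS s; lia.
Qed.

Lemma polar_has_max : exists2 U, U \in P & \dim U = d.
Proof.
have P_gt0 : (0 < #|P|)%N by apply/card_gt0P; exists 0%VS; apply: polar0 PG.
by have [U UP dU] := eq_bigmax_cond (fun U : {vspace V} => \dim U) P_gt0; exists U.
Qed.

(** For [W] of the largest dimension, [W :&: perp U] lies in the inclusion-maximal [U], and
    [dim_cap_perp_geq] then forces [\dim U] up to [\dim W]. *)
Lemma generators_dim U : (U \in gens) = (U \in P) && (\dim U == d).
Proof.
apply/idP/andP => [Ug|[UP /eqP dU]].
  have UP : U \in P by move: Ug; rewrite inE => /andP[].
  split=> //; rewrite eqn_leq polar_dim_leq //=.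
  have [W WP <-] := polar_has_max.
  have s := cap_perp_max Ug WP.
  have s2 : (W :&: perp U <= U :&: W)%VS by rewrite subv_cap s capvSl.
  by have := dim_cap_perp_geq U WP; have := dimvS s2; lia.
rewrite inE UP; apply/forall_inP => W WP; apply/implyP => sUW.
by rewrite eq_sym eqEdim sUW dU polar_dim_leq.
Qed.

Lemma generatorsP U : reflect (U \in P /\ \dim U = d) (U \in gens).
Proof.
by rewrite generators_dim; apply: (iffP andP) => -[? /eqP].
Qed.

Lemma gen_polar U : U \in gens -> U \in P. Proof. by case/generatorsP. Qed.
Lemma gen_dim U : U \in gens -> \dim U = d. Proof. by case/generatorsP. Qed.

Lemma gen_eq U W : U \in gens -> W \in P -> (U <= W)%VS -> U = W.
Proof.
by move=> /gen_dim dU WP s; apply: subv_dim_eq; rewrite ?dU ?polar_dim_leq.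
Qed.

Lemma has_gen : exists U, U \in gens.
Proof. by have [U UP dU] := polar_has_max; exists U; apply/generatorsP. Qed.

(** The conditions that [X] modulo [X :&: y] imposes on [y] are independent, as otherwise
    [X + (y :&: perp X)] would be totally isotropic of dimension above [d]. *)
Lemma dim_gen_cap_perp X y : X \in P -> y \in gens ->
  (\dim (y :&: perp X) + \dim X = d + \dim (X :&: y))%N.
Proof.
move=> XP yg; apply/eqP; rewrite eqn_leq -{2}(gen_dim yg) dim_cap_perp_geq ?andbT ?gen_polar //.
have sP : (X + (y :&: perp X))%VS \in P.
  apply: (polarD PG) => //; last by rewrite (perpC PG) capvSr.
  by apply: (polarS PG (gen_polar yg)); apply: capvSl.
have s : (X :&: (y :&: perp X) <= X :&: y)%VS.
  by rewrite subv_cap capvSl (subv_trans (capvSr _ _)) ?capvSl.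
by have := polar_dim_leq sP; have := dimvS s; have := dimv_sum_cap X (y :&: perp X); lia.
Qed.

(** The projection in the dual polar graph: for a generator [y] and [X] in [P], the generator on [X]
    nearest to [y]. *)
Definition proj X y := (X + (y :&: perp X))%VS.

Lemma proj_gen X y : X \in P -> y \in gens -> proj X y \in gens.
Proof.
move=> XP yg; have yP := gen_polar yg; apply/generatorsP.
have sP : proj X y \in P.
  apply: (polarD PG) => //; last by rewrite (perpC PG) capvSr.
  by apply: (polarS PG yP); apply: capvSl.
split=> //; apply/eqP; rewrite eqn_leq polar_dim_leq //=.
have := dimv_sum_cap X (y :&: perp X); rewrite -/(proj X y).
have s : (X :&: (y :&: perp X) <= X :&: y)%VS.
  by rewrite subv_cap capvSl (subv_trans (capvSr _ _)) ?capvSl.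
by have := dim_gen_cap_perp XP yg; have := dimvS s; lia.
Qed.

Lemma polar_in_gen X : X \in P -> exists2 U, U \in gens & (X <= U)%VS.
Proof.
have [y yg] := has_gen; move=> XP; exists (proj X y); first exact: proj_gen.
exact: addvSl.
Qed.

Lemma dim_triple U y z : U \in P -> y \in P -> z \in P ->
  (\dim (U :&: y) + \dim (z :&: U) + \dim (z :&: y) <=
     d + 2 * \dim (z :&: (U :&: y)))%N.
Proof.
move=> UP yP zP; set K := (U :&: y)%VS; pose B := ((z :&: U) + (z :&: y))%VS.
have sKP : (K + B)%VS \in P.
  apply: (polarD PG); first by apply: (polarS PG UP); apply: capvSl.
    by apply: (polarS PG zP); rewrite subv_add !capvSl.
  rewrite (perpC PG) subv_add; apply/andP; split.
    by apply: (polar_sub_perp UP); rewrite ?capvSl ?capvSr.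
  by apply: (polar_sub_perp yP); rewrite ?capvSr.
have s1 : (K :&: B <= z :&: K)%VS.
  rewrite subv_cap capvSl andbT; apply: subv_trans (capvSr _ _) _.
  by rewrite subv_add !capvSl.
have s2 : ((z :&: U) :&: (z :&: y) <= z :&: K)%VS.
  rewrite !subv_cap (subv_trans (capvSl _ _)) ?capvSl //=.
  by rewrite (subv_trans (capvSl _ _)) ?capvSr //= (subv_trans (capvSr _ _)) ?capvSr.
have := polar_dim_leq sKP; have := dimvS s1; have := dimvS s2.
have := dimv_sum_cap K B; have := dimv_sum_cap (z :&: U) (z :&: y); rewrite -/B; lia.
Qed.

(** * Numbers of generators with prescribed intersections *)

Definition gens_on X : {set {vspace V}} := [set z in gens | (X <= z)%VS].

Lemma in_gens_on X z : (z \in gens_on X) = (z \in gens) && (X <= z)%VS.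
Proof. by rewrite in_set. Qed.

Variable E : nat.
Hypothesis card_gens_hyper : forall H, H \in P -> (\dim H).+1 = d ->
  #|gens_on H| = E.+1.

(** For [z] in the fibre, [z :&: z'] is a hyperplane [H] of [z'] on [W] but not on [X]. There are
    $q^{d-\dim X}$ such [H], and each lies on [E] generators other than [z'], all of which belong to
    the fibre. *)
Lemma card_proj_fiber W X z' : X \in P -> (W <= X)%VS -> \dim X = (\dim W).+1 ->
    z' \in gens_on X ->
  #|[set z in gens_on W | ~~ (X <= z)%VS && (proj X z == z')]| =
    (q ^ (d - \dim X) * E)%N.
Proof.
move=> XP sWX dX; rewrite in_gens_on => /andP[z'g sXz'].
have z'P := gen_polar z'g; have dz' := gen_dim z'g.
pose B := [set H in intervalv W z' d.-1 | ~~ (X <= H)%VS].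
have leXd : (\dim X <= d)%N by rewrite -dz' dimvS.
have XzW z : (W <= z)%VS -> ~~ (X <= z)%VS -> (X :&: z)%VS = W.
  move=> sWz nXz; apply/esym/subv_dim_eq; first by rewrite subv_cap sWX.
  rewrite -ltnS -dX ltn_neqAle dimvS ?capvSl // andbT.
  apply: contra nXz => /eqP eq_d.
  by rewrite -(subv_dim_eq (capvSl X z)) ?eq_d ?capvSr.
have -> : (q ^ (d - \dim X))%N = #|B|.
  have -> : B = intervalv W z' d.-1 :\: intervalv X z' d.-1.
    apply/setP=> H; rewrite !inE; case: (boolP (X <= H)%VS) => sXH /=.
      by rewrite andbF; case: (H <= z')%VS; case: (_ == _); rewrite ?andbF.
    by rewrite andbT.
  have sI : intervalv X z' d.-1 \subset intervalv W z' d.-1.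
    apply/subsetP=> H /intervalvP[sXH sHz dH]; apply/intervalvP; split=> //.
    exact: subv_trans sXH.
  have d0 : (0 < d)%N by lia.
  rewrite cardsD (setIidPr sI) !card_intervalv ?(subv_trans sWX) ?dz' //; try lia.
  have -> : (d - d.-1 = 1)%N by lia.
  have -> : (d - \dim W = (d - \dim X).+1)%N by lia.
  have := gbin_shift q_gt1 (leq0n (d - \dim X)).
  by rewrite gbinS gbin0 subn0 expn1; lia.
apply: (@card_fibers _ _ _ _ (fun z => (z :&: z')%VS)) => [z|H].
  rewrite in_set in_gens_on => /andP[/andP[zg sWz] /andP[nXz /eqP pz]].
  have zz' : (z :&: z' = z :&: perp X)%VS.
    apply/eqP; rewrite eqEsubv !subv_cap !capvSl /=; apply/andP; split.
      by apply: subv_trans (capvSr _ _) _; apply: (polar_sub_perp z'P).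
    by rewrite -pz addvSr.
  have := dim_gen_cap_perp XP zg; rewrite XzW // => dzX.
  rewrite in_set inE subv_cap sWz (subv_trans sWX sXz') capvSr /= zz'.
  apply/andP; split.
    by apply/eqP; lia.
  by apply: contra nXz => /subv_trans; apply; apply: capvSl.
rewrite inE => /andP[/intervalvP[sWH sHz' dH] nXH].
have HP := polarS PG z'P sHz'.
have XHz' : (X + H)%VS = z'.
  apply: subv_dim_eq; first by rewrite subv_add sXz'.
  have /subvPn[x xX xH] := nXH.
  rewrite dz'; have := dimv_add_line xH.
  have s : (H + <[x]> <= X + H)%VS by rewrite addvC addvS // -memvE.
  by have := dimvS s; dlia.
have -> : E = #|gens_on H :\ z'|.
  have := cardsD1 z' (gens_on H); rewrite card_gens_hyper //; last by lia.
  by rewrite in_gens_on z'g sHz' add1n => -[].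
apply: eq_card => z; rewrite in_setD1 in_gens_on in_set in_set in_gens_on.
apply/idP/idP.
  case/andP=> /andP[/andP[zg sWz] /andP[nXz /eqP pz]] /eqP zz'.
  rewrite zg -zz' capvSl /= andbT; apply: contraNneq nXz => ->.
  exact: sXz'.
case/andP=> neq_zz' /andP[zg sHz].
have nXz : ~~ (X <= z)%VS.
  apply: contra neq_zz' => sXz; rewrite eq_sym; apply/eqP/gen_eq => //.
    exact: gen_polar.
  by rewrite -XHz' subv_add sXz.
rewrite zg nXz (subv_trans sWH) //=; apply/andP; split.
  rewrite eq_sym; apply/eqP/gen_eq => //; first by apply/gen_polar/proj_gen.
  rewrite -{1}XHz' subv_add addvSl /= (subv_trans _ (addvSr _ _)) // subv_cap sHz.
  exact: (polar_sub_perp z'P).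
have zz'H : (H <= z :&: z')%VS by rewrite subv_cap sHz.
rewrite eq_sym eqEdim zz'H /= dH.
have : (\dim (z :&: z') != d)%N.
  apply: contra neq_zz' => /eqP dzz.
  have e1 : (z :&: z')%VS = z by apply: subv_dim_eq; rewrite ?capvSl ?dzz ?gen_dim.
  by apply/eqP/gen_eq => //; rewrite -e1 capvSr.
move=> neq; have := dimvS (capvSr z z'); move: neq; rewrite dz'; clear; lia.
Qed.

(** With [X1] one dimension above [X], a generator on [X] either contains [X1] or is sent by
    [proj X1] to one that does, and the fibres have constant size. *)
Lemma card_gens_on X : X \in P -> #|gens_on X| = gen_count q E (d - \dim X).
Proof.
move En: (d - \dim X)%N => n; elim: n X En => [|n IH] X En XP.
  have Xg : X \in gens by apply/generatorsP; split; have := polar_dim_leq XP; lia.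
  rewrite /gen_count big_ord0 (_ : gens_on X = [set X]) ?cards1 //.
  apply/setP=> z; rewrite in_gens_on in_set1; apply/andP/eqP => [[zg sXz]|->].
    by apply/esym/gen_eq => //; apply: gen_polar.
  by rewrite subvv.
have [U Ug sXU] := polar_in_gen XP.
have [||X1 [sXX1 sX1U dX1]] := @subv_between _ _ X U (\dim X).+1 => //.
  by rewrite (gen_dim Ug); lia.
have X1P := polarS PG (gen_polar Ug) sX1U.
have sub1 : gens_on X1 \subset gens_on X.
  by apply/subsetP=> z; rewrite !in_gens_on => /andP[-> /(subv_trans sXX1) ->].
rewrite gen_countS mulnDr muln1 -{1}(IH X1) //; last by lia.
rewrite -(setIidPr sub1) -(cardsID (gens_on X1) (gens_on X)) (setIidPr sub1); congr addn.
rewrite -(IH X1) //; last by lia.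
rewrite (_ : n = d - \dim X1)%N; last by lia.
apply: (@card_fibers _ _ _ _ (proj X1)) => [z|z' z'X1].
  rewrite in_setD !in_gens_on => /andP[_ /andP[zg _]].
  by rewrite addvSl andbT; apply: proj_gen.
rewrite -(card_proj_fiber X1P sXX1 dX1 z'X1); apply: eq_card => z.
rewrite [LHS]in_set [RHS]in_set in_setD !in_gens_on.
by case: (z \in gens) => //=; case: (X1 <= z)%VS; case: (X <= z)%VS.
Qed.

(** For [X1] in [U] one dimension above [X], [proj X1] turns the trace [X] on [U] into the trace
    [X1], again with fibres counted by [card_proj_fiber]. *)
Lemma card_gens_meet U X : U \in gens -> (X <= U)%VS ->
  #|[set z in gens | (z :&: U)%VS == X]| =
    (q ^ 'C(d - \dim X, 2) * E ^ (d - \dim X))%N.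
Proof.
move=> Ug; have UP := gen_polar Ug; have dU := gen_dim Ug.
move En: (d - \dim X)%N => n; elim: n X En => [|n IH] X En sXU.
  have XU : X = U by apply: subv_dim_eq; lia.
  rewrite bin_small // !expn0 (_ : [set z in _ | _] = [set U]) ?cards1 //.
  apply/setP=> z; rewrite in_set in_set1 XU; apply/andP/eqP => [[zg /eqP zU]|->].
    by apply/esym/gen_eq; rewrite ?(gen_polar zg) // -zU capvSl.
  by rewrite capvv.
have [||X1 [sXX1 sX1U dX1]] := @subv_between _ _ X U (\dim X).+1 => //; first by lia.
have X1P := polarS PG UP sX1U.
have -> : (q ^ 'C(n.+1, 2) * E ^ n.+1 =
           q ^ 'C(n, 2) * E ^ n * (q ^ (d - \dim X1) * E))%N.
  by rewrite (_ : d - \dim X1 = n)%N ?binS ?bin1 ?expnD ?expnS; lia.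
rewrite -(IH X1) //; last by lia.
have XzW z : (z :&: U)%VS = X -> (X <= z)%VS /\ ~~ (X1 <= z)%VS.
  move=> zU; rewrite -{1}zU capvSl; split=> //; apply/negP=> sX1z.
  have : (X1 <= X)%VS by rewrite -zU subv_cap sX1z.
  by move/dimvS; lia.
apply: (@card_fibers _ _ _ _ (proj X1)) => [z|z'].
  rewrite in_set => /andP[zg /eqP zU]; rewrite in_set.
  rewrite proj_gen //=; have [sXz nX1z] := XzW _ zU.
  rewrite /proj -vspace_modl //; apply/eqP/addv_idPl.
  by rewrite (subv_trans _ sXX1) // -zU subv_cap capvSr (subv_trans (capvSl _ _)) ?capvSl.
rewrite in_set => /andP[z'g /eqP z'U].
have z'X1 : z' \in gens_on X1 by rewrite in_gens_on z'g -z'U capvSl.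
rewrite -(card_proj_fiber X1P sXX1 dX1 z'X1); apply: eq_card => z.
rewrite [LHS]in_set [RHS]in_set [X in X && _ = _]in_set in_gens_on.
apply/idP/idP.
  case/andP=> /andP[zg /eqP zU] ->; have [-> ->] := XzW _ zU.
  by rewrite zg.
case/andP=> /andP[zg sXz] /andP[nX1z pz]; rewrite zg pz andbT /=.
rewrite eqEsubv subv_cap sXz sXU !andbT.
have s1 : (z :&: U <= z')%VS.
  rewrite -(eqP pz) (subv_trans _ (addvSr _ _)) // subv_cap capvSl /=.
  by apply: subv_trans (capvSr _ _) _; apply: (polar_sub_perp UP).
have s2 : (z :&: U <= X1 :&: z)%VS.
  by rewrite subv_cap capvSl andbT -z'U subv_cap s1 capvSr.
apply: (subv_trans s2).
have sX : (X <= X1 :&: z)%VS by rewrite subv_cap sXX1.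
rewrite -(subv_dim_eq sX) //.
rewrite -ltnS -dX1 ltn_neqAle dimvS ?capvSl // andbT.
apply: contra nX1z => /eqP eq_d.
by rewrite -(subv_dim_eq (capvSl X1 z)) ?eq_d ?capvSr.
Qed.

(** Each such [z] contains some [W] of dimension [w] in [K] and some [X] of dimension [m] between
    [W] and [U]; all triples [W], [X], [z] are counted. *)
Lemma card_gens_meeting2_leq U K m w : U \in gens -> (K <= U)%VS ->
    (w <= \dim K)%N -> (w <= m <= d)%N ->
  (#|[set z in gens | (m <= \dim (z :&: U))%N && (w <= \dim (z :&: K))%N]|
     <= gbin q (\dim K) (\dim K - w) *
        (gbin q (d - w) (d - m) * gen_count q E (d - m)))%N.
Proof.
move=> Ug sKU lewK /andP[lewm lemd]; have dU := gen_dim Ug; have UP := gen_polar Ug.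
have := @card_intervalv _ _ 0%VS K w (sub0v _) lewK; rewrite dimv0 subn0 => <-.
apply: (@card_cover_leq _ _ _ _
  (fun W => [set z in gens | (W <= z)%VS && (m <= \dim (z :&: U))%N])) => [z|W].
  rewrite in_set => /and3P[zg lem lew].
  have [|W [_ sW dW]] := @subv_between _ _ 0%VS (z :&: K)%VS w (sub0v _).
    by rewrite dimv0 lew.
  exists W; first by apply/intervalvP; rewrite sub0v (subv_trans sW) ?capvSr.
  by rewrite in_set zg lem (subv_trans sW) ?capvSl.
case/intervalvP=> _ sWK dW; have sWU := subv_trans sWK sKU.
have := @card_intervalv _ _ W U m sWU; rewrite dU dW => <- //.
apply: (@card_cover_leq _ _ _ _ gens_on) => [z|X].
  rewrite in_set => /and3P[zg sWz lem].
  have [||X [sWX sX dX]] := @subv_between _ _ W (z :&: U)%VS m.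
  - by rewrite subv_cap sWz.
  - by rewrite dW lewm.
  exists X; first by apply/intervalvP; rewrite sWX (subv_trans sX) ?capvSr.
  by rewrite in_set zg (subv_trans sX) ?capvSl.
case/intervalvP=> _ sXU dX; rewrite card_gens_on ?dX //.
by apply: (polarS PG UP).
Qed.

End PolarGeometry.

(** * Large families at bounded distance *)

Lemma bin2_sq n : (2 * 'C(n, 2) + n = n * n)%N.
Proof. by elim: n => // n IH; rewrite binS bin1; lia. Qed.

(** A codimension [a] in [K] that falls short of [n] by [j] saves [j * w] in the exponent of [q]. In
    the uses [D + j] does not depend on [j], so one lower bound for the saving serves all [K]. *)
Lemma exp_trade n m w a j j0 D : n = (a + j)%N -> (j0 <= j)%N -> (j0 <= D)%N ->
  (D <= w <= m)%N -> (a * w + n * (m - w) + j0 * (D + j - j0) <= n * m)%N.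
Proof.
move=> -> lej leD /andP[leDw lewm].
have [r rE] : exists r, m = (w + r)%N by exists (m - w)%N; lia.
have [x xE] : exists x, j = (j0 + x)%N by exists (j - j0)%N; lia.
have h1 : (j0 * D <= j0 * w)%N by rewrite leq_mul2l leDw orbT.
have h2 : (j0 * x <= w * x)%N by rewrite leq_mul2r (leq_trans leD) ?orbT.
rewrite rE xE addKn (_ : D + (j0 + x) - j0 = D + x)%N; last by lia.
by lia.
Qed.

Lemma half_sum_lt y a b L : (y <= a + b -> 2 * a < L -> 2 * b < L -> y < L)%N.
Proof. by lia. Qed.

Lemma third_sum_lt y a b c L :
  (y <= a + b + c -> 3 * a < L -> 3 * b < L -> 3 * c < L -> y < L)%N.
Proof. by lia. Qed.

(* [q ^ kp] absorbs the constants of the estimates: [kp = 13] works for [q = 2]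
   and [kp = 5] for [q >= 3]. *)
Definition large_rank (t kp d : nat) : Prop :=
  (kp = 13 /\ 9 * (t + 2) ^ 2 <= 8 * d \/ kp = 5 /\ 5 * (t + 2) ^ 2 <= 8 * d)%N.

Lemma large_rankE t kp d : large_rank t kp d ->
  (kp = 13 /\ 9 * (t * t + 4 * t + 4) <= 8 * d \/
   kp = 5 /\ 5 * (t * t + 4 * t + 4) <= 8 * d)%N.
Proof. by rewrite /large_rank !expnS expn0; case=> -[-> h]; [left | right]; lia. Qed.

Lemma large_rank_geq t kp d s : (2 * s <= t)%N -> (0 < s)%N -> large_rank t kp d ->
  (3 * s + 5 <= d)%N.
Proof.
move=> le s0 /large_rankE h.
have : (4 * (s * s) <= t * t)%N by rewrite -[4%N]/(2 * 2)%N -mulnACA leq_mul.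
have : (s <= s * s)%N by rewrite leq_pmull.
by lia.
Qed.

(** For the members of [Y] meeting [A] in more than the generic dimension; the bracket is the price
    of passing from [opp_count (2 * s)] to [opp_count s]. At [s = 1] it is an equality for
    [kp = 13], [d = 18] and for [kp = 5], [d = 10]. *)
Lemma exp_even_excess d s kp : (0 < s)%N -> large_rank (2 * s) kp d ->
  (s.-1 * (d - 2 * s - s).+1 + 2 * s * s.-1 + (s * s + 'C(s, 2) + 3 * s) + kp
     <= s * (d - s))%N.
Proof.
move=> s0 h; have := large_rank_geq (leqnn _) s0 h; move/large_rankE: h.
have := bin2_sq s; case: s s0 => // s _ hb h led.
have [D DE] : exists D, d = (D + 3 * s.+1)%N by exists (d - 3 * s.+1)%N; lia.
have -> : (d - 2 * s.+1 - s.+1 = D)%N by lia.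
have -> : (d - s.+1 = D + 2 * s.+1)%N by lia.
by lia.
Qed.

(** [s * s] pays for the choice of [X]; the right-hand side is the saving of [exp_trade] with
    [j0 = 1]. *)
Lemma exp_even_proj d s kp : (0 < s)%N -> large_rank (2 * s) kp d ->
  (s * s + kp <= d - 2 * s - 1)%N.
Proof.
move=> s0 h; have := large_rank_geq (leqnn _) s0 h; move/large_rankE: h.
have : (s <= s * s)%N by rewrite leq_pmull.
by lia.
Qed.

Lemma exp_odd_excess d s kp : (0 < s)%N -> large_rank (2 * s).+1 kp d ->
  (s.-1 * (d - (2 * s).+1 - s).+1 + (2 * s).+1 * s.-1 +
     (s.+1 * s + 'C(s, 2) + 3 * s) + kp <= s * (d - s.+1))%N.
Proof.
move=> s0 h; have := large_rank_geq (leqnSn _) s0 h; move/large_rankE: h.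
have := bin2_sq s; case: s s0 => // s _ hb h led.
have [D DE] : exists D, d = (D + 3 * s.+1 + 1)%N by exists (d - 3 * s.+1 - 1)%N; lia.
have -> : (d - (2 * s.+1).+1 - s.+1 = D)%N by lia.
have -> : (d - s.+2 = D + 2 * s.+1)%N by lia.
by lia.
Qed.

(** [s.+1 * s] pays for the choice of [X]; the saving comes from [exp_trade] with [j0 = 2]. *)
Lemma exp_odd_proj d s kp : (0 < s)%N -> large_rank (2 * s).+1 kp d ->
  (s.+1 * s + (s.+1 * (d - s.+1) - 2 * (d - 2 * s - 3)) + kp <= s * (d - s.+1))%N.
Proof.
move=> s0 h; have := large_rank_geq (leqnSn _) s0 h; move/large_rankE: h.
have : (s <= s * s)%N by rewrite leq_pmull.
move=> hs h led.
have [D DE] : exists D, d = (D + 2 * s + 3)%N by exists (d - 2 * s - 3)%N; lia.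
have -> : (d - 2 * s - 3 = D)%N by lia.
have -> : (d - s.+1 = D + s + 2)%N by lia.
have h1 : (s * 1 <= s * D)%N by rewrite leq_mul2l; lia.
have h2 : (2 * D <= s.+1 * D)%N by rewrite leq_mul2r; lia.
by lia.
Qed.

(** For the members that are projected a second time; the extra [s.+1] pays for the choice of the
    hyperplane [H] of [U]. *)
Lemma exp_odd_proj2 d s kp : (0 < s)%N -> large_rank (2 * s).+1 kp d ->
  (s.+1 * s + s.+1 + (s * (d - s) - (d - 2 * s - 2)) + kp <= s * (d - s.+1))%N.
Proof.
move=> s0 h; have := large_rank_geq (leqnSn _) s0 h; move/large_rankE: h.
have : (s <= s * s)%N by rewrite leq_pmull.
move=> hs h led.
have [D DE] : exists D, d = (D + 2 * s + 2)%N by exists (d - 2 * s - 2)%N; lia.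
have -> : (d - 2 * s - 2 = D)%N by lia.
have -> : (d - s = D + s + 2)%N by lia.
have -> : (d - s.+1 = D + s + 1)%N by lia.
have h2 : (1 * D <= s * D)%N by rewrite leq_mul2r; lia.
by lia.
Qed.

(** * Families for which no generator is close to all members *)

Section LargeEKR.
Variables (F : finFieldType) (V : vectType F).
Variables (P : {set {vspace V}}) (perp : {vspace V} -> {vspace V}).
Hypothesis PG : polar_geometry P perp.
Implicit Types (U W X y z g H K A : {vspace V}) (Y : {set {vspace V}}).
Local Notation q := #|F|.
Local Notation d := (polar_rank P).
Local Notation gens := (generators P).
Local Notation Q := (qconst q).
Local Notation proj := (proj perp).

Let q_gt1 : (1 < q)%N. Proof. exact: card_finNzRing_gt1. Qed.

Variable E : nat.
Hypothesis card_gens_hyper : forall H, H \in P -> (\dim H).+1 = d ->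
  #|gens_on P H| = E.+1.
Hypothesis E_gt0 : (0 < E)%N.
(** In the classical polar spaces $E=q^e$ with $e\le 2$; the exponent 3 is what the dimension count
    of [card_gens_on_leq] yields. *)
Definition few_gens : Prop := (E <= q ^ 3)%N.
Hypothesis E_leq : few_gens.

(** In rank [n], the number of generators that meet a fixed one trivially. *)
Definition opp_count n := (q ^ 'C(n, 2) * E ^ n)%N.

Lemma opp_count_gt0 n : (0 < opp_count n)%N.
Proof. by rewrite muln_gt0 !expn_gt0 E_gt0 (ltnW q_gt1). Qed.

Lemma opp_count_leq n k :
  (opp_count (n + k) <= q ^ (n * k + 'C(k, 2) + 3 * k) * opp_count n)%N.
Proof.
rewrite /opp_count; have -> : 'C(n + k, 2) = ('C(n, 2) + (n * k + 'C(k, 2)))%N.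
  by have := bin2_sq (n + k); have := bin2_sq n; have := bin2_sq k; lia.
have hE : (E ^ k <= q ^ (3 * k))%N.
  by rewrite expnM; elim: k => // k IH; rewrite (expnS E) (expnS (q ^ 3)%N) leq_mul.
rewrite (expnD E) mulnA; apply: leq_trans (leq_mul (leqnn _) hE) _.
by rewrite !expnD; apply: eq_leq; lia.
Qed.

Lemma opp_count_mono n : (opp_count n <= opp_count n.+1)%N.
Proof.
apply: leq_mul; last by rewrite expnS leq_pmull.
by rewrite leq_pexp2l ?(ltnW q_gt1) // binS leq_addr.
Qed.

Lemma card_gens_cap_in g U m : g \in gens -> (U <= g)%VS -> (m <= \dim U)%N ->
  #|[set z in gens | (z :&: g)%VS \in intervalv 0%VS U m]| =
    (gbin q (\dim U) (\dim U - m) * opp_count (d - m))%N.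
Proof.
move=> gg sUg lem; have := card_intervalv (sub0v U) lem; rewrite dimv0 subn0 => <-.
apply: (@card_fibers _ _ _ _ (fun z => (z :&: g)%VS)) => [z|X XI].
  by rewrite in_set => /andP[].
have /intervalvP[_ sXU dX] := XI.
rewrite -[in RHS]dX /opp_count -(card_gens_meet PG card_gens_hyper gg (subv_trans sXU sUg)).
apply: eq_card => z; rewrite [LHS]in_set [RHS]in_set in_set.
by case: (z \in gens) => //=; case: eqP => [->|_]; rewrite ?XI ?andbF.
Qed.

Lemma card_gens_meeting2_ub U K m w : U \in gens -> (K <= U)%VS ->
    (w <= \dim K)%N -> (w <= m <= d)%N ->
  (#|[set z in gens | (m <= \dim (z :&: U))%N && (w <= \dim (z :&: K))%N]|
     <= 2 * Q ^ 3 * q ^ ((\dim K - w) * w + (d - m) * (m - w)) * opp_count (d - m))%N.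
Proof.
move=> Ug sKU lewK lewm.
apply: leq_trans (card_gens_meeting2_leq PG card_gens_hyper Ug sKU lewK lewm) _.
have h1 := gbin_ub q_gt1 (leq_subr w (\dim K)).
have h2 : (gbin q (d - w) (d - m) <= Q * q ^ ((d - m) * (m - w)))%N.
  have := @gbin_ub _ q_gt1 (d - w) (d - m).
  have -> : (d - w - (d - m) = m - w)%N by lia.
  by apply; lia.
have h3 := gen_count_ub q_gt1 (d - m) E_gt0.
have := leq_mul h1 (leq_mul h2 h3); rewrite subKn // -/(opp_count _) expnD.
move=> h; apply: leq_trans h _; apply: eq_leq.
by rewrite !expnS expn0; move: (opp_count _) (q ^ _)%N (q ^ _)%N => x1 x2 x3; lia.
Qed.

Lemma pselect_gens (Y : {set {vspace V}}) k :
  (exists2 U, U \in gens & {in Y, forall y, (k <= \dim (y :&: U))%N}) \/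
  (forall U, U \in gens -> exists2 y, y \in Y & (\dim (U :&: y) < k)%N).
Proof.
case: (boolP [exists U in gens, [forall y in Y, (k <= \dim (y :&: U))%N]]).
  by case/exists_inP=> U Ug /forall_inP YU; left; exists U.
rewrite negb_exists_in => /forall_inP noU; right=> U /noU.
rewrite negb_forall_in => /exists_inP[y yY]; rewrite -ltnNge capvC => lt.
by exists y.
Qed.

Lemma exp_lt c kp a b : (c < q ^ kp)%N -> (a + kp <= b)%N -> (c * q ^ a < q ^ b)%N.
Proof.
move=> ltc le; apply: (@leq_trans (q ^ kp * q ^ a)).
  by rewrite ltn_pmul2r // expn_gt0 ltnW.
by rewrite -expnD leq_exp2l // addnC.
Qed.

Section FixedFamily.
Variables (t kp : nat) (Y : {set {vspace V}}).
(** [6 * Q ^ 5] dominates the constants of all error terms; it equals $6144<2^{13}$ for $q=2$ and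
    $192<3^5$ for $q\ge 3$. *)
Definition const_absorbed : Prop := (6 * Q ^ 5 < q ^ kp)%N.
Hypothesis kpP : const_absorbed.
Hypothesis sYg : Y \subset gens.
Hypothesis Yt : {in Y &, forall y1 y2, (d - t <= \dim (y1 :&: y2))%N}.

Let Yg y : y \in Y -> y \in gens. Proof. exact: subsetP. Qed.
Let YP y : y \in Y -> y \in P. Proof. by move/Yg/(gen_polar PG). Qed.

Lemma card_Y_small U K m w e : U \in gens -> (K <= U)%VS -> (w <= m <= d)%N ->
    ((w <= \dim K)%N -> ((\dim K - w) * w + (d - m) * (m - w) <= e)%N) ->
  (#|[set z in Y | (m <= \dim (z :&: U))%N && (w <= \dim (z :&: K))%N]|
     <= 2 * Q ^ 3 * q ^ e * opp_count (d - m))%N.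
Proof.
move=> Ug sKU lewm le_e; case: (leqP w (\dim K)) => lewK.
  apply: leq_trans (_ : _ <= 2 * Q ^ 3 *
    q ^ ((\dim K - w) * w + (d - m) * (m - w)) * opp_count (d - m))%N _; last first.
    by rewrite leq_mul // leq_mul // leq_pexp2l ?le_e // ltnW.
  apply: leq_trans (card_gens_meeting2_ub Ug sKU lewK lewm).
  apply: subset_leq_card; apply/subsetP=> z; rewrite !in_set => /andP[/Yg].
  by rewrite in_set => /andP[-> ->].
rewrite (_ : [set z in Y | _] = set0) ?cards0 //.
apply/setP=> z; rewrite in_set in_set0; apply/negbTE/negP => /and3P[_ _].
by have := dimvS (capvSr z K); dlia.
Qed.

Lemma small_lt c a b o : (c <= 6 * Q ^ 5)%N -> (a + kp <= b)%N -> (0 < o)%N ->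
  (c * q ^ a * o < q ^ b * o)%N.
Proof.
by move=> lec le o_gt0; rewrite ltn_pmul2r // (exp_lt _ le) // (leq_ltn_trans lec).
Qed.

Lemma qconst_gt1 : (2 <= Q)%N. Proof. by rewrite /qconst; case: ifP. Qed.

Section Pair.
Variables (y1 y2 : {vspace V}) (s : nat).
Hypotheses (y1Y : y1 \in Y) (y2Y : y2 \in Y).
Local Notation A := (y1 :&: y2)%VS.
Hypothesis dA : \dim A = (d - t)%N.
Hypothesis led : (3 * t <= d)%N.
Hypothesis tE : t./2 = s.

Let leAz z : z \in Y -> (d - t - s <= \dim (z :&: A))%N.
Proof.
move=> zY; have := dim_triple PG (YP y1Y) (YP y2Y) (YP zY).
by have := Yt zY y1Y; have := Yt zY y2Y; rewrite dA; dlia.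
Qed.

Lemma generic_proj z : z \in Y -> \dim (z :&: A) = (d - t - s)%N ->
  exists2 X, X \in intervalv A y1 (d - t + s)%N
    & (d - t + s <= \dim (z :&: proj X y2))%N.
Proof.
move=> zY dzA.
(* [z :&: y1] may exceed dimension [d - t]; cutting it down to [Z] gives all [X] the same dimension,
   so that they can be counted. *)
have [||Z [sAZ sZ dZ]] := @subv_between _ _ (z :&: A)%VS (z :&: y1)%VS (d - t)%N.
- by rewrite subv_cap capvSl (subv_trans (capvSr _ _)) ?capvSl.
- by rewrite dzA (Yt zY y1Y) andbT; dlia.
have sZz : (Z <= z)%VS := subv_trans sZ (capvSl _ _).
have sZy : (Z <= y1)%VS := subv_trans sZ (capvSr _ _).
have sA1 : (A <= y1)%VS := capvSl _ _.
have AZ : (A :&: Z)%VS = (z :&: A)%VS.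
  apply/eqP; rewrite eqEsubv; apply/andP; split; rewrite subv_cap.
    by rewrite (subv_trans (capvSr _ _) sZz) capvSl.
  by rewrite capvSr sAZ.
exists (A + Z)%VS.
  apply/intervalvP; split; rewrite ?addvSl ?subv_add ?sA1 //.
  by have := dimv_sum_cap A Z; rewrite AZ dzA dA dZ; dlia.
have s1 : (Z + (z :&: y2) <= z :&: proj (A + Z) y2)%VS.
  rewrite subv_cap !subv_add sZz capvSl /=; apply/andP; split.
    by rewrite (subv_trans _ (addvSl _ _)) // addvSr.
  rewrite (subv_trans _ (addvSr _ _)) // subv_cap capvSr /=.
  rewrite (perpC PG) subv_add; apply/andP; split.
    by apply: (polar_sub_perp PG (YP y2Y)); rewrite capvSr.
  by apply: (polar_sub_perp PG (YP zY)); rewrite ?capvSl.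
have s2 : (Z :&: (z :&: y2) <= z :&: A)%VS.
  rewrite !subv_cap (subv_trans (capvSl _ _) sZz) (subv_trans (capvSl _ _) sZy).
  by rewrite (subv_trans (capvSr _ _)) ?capvSr.
have := dimvS s1; have := dimvS s2; have := dimv_sum_cap Z (z :&: y2).
by have := Yt zY y2Y; rewrite dzA dZ; dlia.
Qed.

(* The members of [Y] meeting [A] in more than the generic dimension, bounded
   through [y1], and the others, distributed over the projections. *)
Lemma card_Y_split c :
  {in intervalv A y1 (d - t + s)%N, forall X,
     (#|[set z in Y | (d - t + s <= \dim (z :&: proj X y2))%N]| <= c)%N} ->
  (#|Y| <= (0 < s) * (2 * Q ^ 3 * q ^ (s.-1 * (d - t - s).+1 + t * s.-1) * opp_count t)
           + Q * q ^ ((t - s) * s) * c)%N.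
Proof.
move=> lec; rewrite -(cardsID [set z in Y | (d - t - s < \dim (z :&: A))%N] Y).
apply: leq_add.
  (* For [s = 0] the generic dimension is [\dim A] itself and nothing exceeds it, hence the factor
     [(0 < s)]. *)
  case: (posnP s) => [s0|s_gt0]; rewrite ?mul0n ?mul1n.
    rewrite leqn0 cards_eq0 -subset0; apply/subsetP=> z; rewrite in_setI !in_set.
    by case/and3P=> _ _; have := dimvS (capvSr z A); rewrite dA; dlia.
  apply: leq_trans (_ : #|[set z in Y | (d - t <= \dim (z :&: y1))%N
                            && ((d - t - s).+1 <= \dim (z :&: A))%N]| <= _)%N.
    apply: subset_leq_card; apply/subsetP=> z; rewrite in_setI !in_set.
    by case/and3P=> zY _ ->; rewrite zY Yt.
  have -> : opp_count t = opp_count (d - (d - t)) by congr opp_count; dlia.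
  apply: (card_Y_small (Yg y1Y) (capvSl _ _)); first by dlia.
  rewrite dA (_ : d - (d - t) = t)%N; last by dlia.
  by rewrite (_ : d - t - (d - t - s).+1 = s.-1)%N //; dlia.
have dy1 := gen_dim PG (Yg y1Y).
have hM : (#|intervalv A y1 (d - t + s)%N| <= Q * q ^ ((t - s) * s))%N.
  rewrite card_intervalv ?capvSl ?dy1 ?dA //; last by dlia.
  have -> : (d - (d - t) = t)%N by dlia.
  have -> : (d - (d - t + s) = t - s)%N by dlia.
  apply: leq_trans (gbin_ub q_gt1 _) _; first by dlia.
  by rewrite (_ : t - (t - s) = s)%N //; dlia.
apply: leq_trans (leq_mul hM (leqnn c)).
apply: (card_cover_leq _ lec) => z; rewrite in_setD !in_set => /andP[+ zY].
rewrite zY /= -leqNgt => le.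
have [|X XI leX] := generic_proj zY; first by have := leAz zY; dlia.
by exists X; rewrite // in_set zY.
Qed.


Lemma even_dichotomy : t = (2 * s)%N -> (0 < s)%N -> large_rank t kp d ->
  (exists2 U, U \in gens & {in Y, forall y, (d - s <= \dim (y :&: U))%N}) \/
  (#|Y| < q ^ (s * (d - s)) * opp_count s)%N.
Proof.
move=> t2s s_gt0 big_d.
have [|noU] := pselect_gens Y (d - s)%N; [by left | right].
have dS : (3 * s + 5 <= d)%N by apply: large_rank_geq s_gt0 big_d; rewrite t2s; dlia.
(* The exponent of the example less the saving of [exp_trade]. *)
pose e := (s * (d - s) - (d - 2 * s - 1))%N.
have tsE : (d - t + s = d - s)%N by dlia.
have lec : {in intervalv A y1 (d - t + s)%N, forall X,
    (#|[set z in Y | (d - t + s <= \dim (z :&: proj X y2))%N]|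
       <= 2 * Q ^ 3 * q ^ e * opp_count s)%N}.
  move=> X /intervalvP[_ sXy1 _]; have XP := polarS PG (YP y1Y) sXy1.
  set U := proj X y2; have Ug : U \in gens by apply: (proj_gen PG) => //; apply: Yg.
  have [y yY ltk] := noU U Ug; set K := (U :&: y)%VS in ltk.
  (* The least dimension of [z :&: K] that [dim_triple] allows, rounded up. As [\dim K < d - s], the
     codimension in [K] is below [s]. *)
  have [w wE] : exists w, w = (\dim K + d - 3 * s).+1./2 by eexists.
  have -> : opp_count s = opp_count (d - (d - s)) by congr opp_count; dlia.
  apply: leq_trans (card_Y_small (e := e) Ug (capvSl U y) (_ : w <= d - s <= d)%N _).
  - apply: subset_leq_card; apply/subsetP=> z; rewrite !in_set => /andP[zY lez].
    rewrite zY -tsE lez /=; have := dim_triple PG (gen_polar PG Ug) (YP yY) (YP zY).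
    by have := Yt zY yY; rewrite -/K; dlia.
  - by dlia.
  rewrite -/K => lewK; rewrite (_ : d - (d - s) = s)%N; last by dlia.
  (* Here [D + j = d - 2 * s] whatever the dimension of [K]. *)
  have := @exp_trade s (d - s) w (\dim K - w) (s - (\dim K - w)) 1
     (d - 2 * s - (s - (\dim K - w))).
  have h : (\dim K - w < s)%N by dlia.
  rewrite (_ : _ + _ - 1 = d - 2 * s - 1)%N; last by dlia.
  move=> /(_ ltac:(dlia) ltac:(dlia) ltac:(dlia) ltac:(dlia)) h'.
  by have := leq_sub2r (1 * (d - 2 * s - 1)) h'; rewrite addnK mul1n.
have := card_Y_split lec; rewrite s_gt0 mul1n.
set S1 := (_ * opp_count t)%N; set S2 := (_ * (_ * opp_count s))%N => leY.
have o0 := opp_count_gt0 s; have Q2 := qconst_gt1.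
have lt1 : (2 * S1 < q ^ (s * (d - s)) * opp_count s)%N.
  have := opp_count_leq s s; rewrite (_ : s + s = t)%N; last by dlia.
  move=> h; apply: leq_ltn_trans (_ : 2 * (2 * Q ^ 3 *
     q ^ (s.-1 * (d - t - s).+1 + t * s.-1) * (q ^ (s * s + 'C(s, 2) + 3 * s) * opp_count s)) < _)%N.
    by rewrite leq_mul // leq_mul.
  rewrite (_ : 2 * _ = 4 * Q ^ 3 * q ^ (s.-1 * (d - t - s).+1 + t * s.-1 +
      (s * s + 'C(s, 2) + 3 * s)) * opp_count s)%N; last first.
    by rewrite (expnD q (_ + t * s.-1)); clear; lia.
  apply: small_lt => //; first by rewrite leq_mul // leq_pexp2l // ltnW.
  by rewrite t2s; apply: exp_even_excess; rewrite -?t2s.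
have lt2 : (2 * S2 < q ^ (s * (d - s)) * opp_count s)%N.
  rewrite /S2 (_ : (t - s) * s = s * s)%N; last by rewrite t2s; congr (_ * _)%N; dlia.
  rewrite (_ : 2 * _ = 4 * Q ^ 4 * q ^ (s * s + e) * opp_count s)%N; last first.
    by rewrite expnD (expnS Q 3); clear; lia.
  apply: small_lt => //; first by rewrite leq_mul // leq_pexp2l // ltnW.
  have h1 : (s * s + kp <= d - 2 * s - 1)%N.
    by apply: exp_even_proj; rewrite -?t2s.
  have h2 : (d - 2 * s - 1 <= s * (d - s))%N.
    by apply: leq_trans (leq_pmull _ s_gt0); dlia.
  by move: h1 h2; rewrite /e; clear; lia.
exact: half_sum_lt leY lt1 lt2.
Qed.

(** For odd [t] a member of [Y] may still meet [K = U :&: y] in codimension exactly [s], which saves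
    too little. This forces equality in [dim_triple], and such members are then within distance [s]
    of one of the generators [proj H y], with [H] a hyperplane of [U] on [K]. *)
Lemma odd_dichotomy : t = (2 * s).+1 -> (0 < s)%N -> large_rank t kp d ->
  (exists2 U, U \in gens & {in Y, forall y, (d - s.+1 <= \dim (y :&: U))%N}) \/
  (#|Y| < q ^ (s * (d - s.+1)) * opp_count s.+1)%N.
Proof.
move=> t2s s_gt0 big_d.
have [|noU] := pselect_gens Y (d - s.+1)%N; [by left | right].
have dS : (3 * s + 5 <= d)%N by apply: large_rank_geq s_gt0 big_d; rewrite t2s; dlia.
(* The exponent starts from [s.+1], that of the example from [s], so [exp_trade] has to save
   twice. *)
pose e2 := (s.+1 * (d - s.+1) - 2 * (d - 2 * s - 3))%N.
pose e3 := (s * (d - s) - (d - 2 * s - 2))%N.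
have tsE : (d - t + s = d - s.+1)%N by dlia.
(* Members within distance [s] of [g]: one saving is enough, and rounding in [dim_triple] keeps the
   codimension in [K] below [s]. *)
have lec3 g : g \in gens ->
    (#|[set z in Y | (d - s <= \dim (z :&: g))%N]|
       <= 2 * Q ^ 3 * q ^ e3 * opp_count s)%N.
  move=> gg; have [y yY ltk] := noU g gg; set K := (g :&: y)%VS in ltk.
  have [w wE] : exists w, w = (\dim K + d - 3 * s - 1).+1./2 by eexists.
  have -> : opp_count s = opp_count (d - (d - s)) by congr opp_count; dlia.
  apply: leq_trans (card_Y_small (e := e3) gg (capvSl g y) (_ : w <= d - s <= d)%N _).
  - apply: subset_leq_card; apply/subsetP=> z; rewrite !in_set => /andP[zY lez].
    rewrite zY lez /=; have := dim_triple PG (gen_polar PG gg) (YP yY) (YP zY).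
    by have := Yt zY yY; rewrite -/K; dlia.
  - by dlia.
  rewrite -/K => lewK; rewrite (_ : d - (d - s) = s)%N; last by dlia.
  have := @exp_trade s (d - s) w (\dim K - w) (s - (\dim K - w)) 1
     (d - 2 * s - 1 - (s - (\dim K - w))).
  have h : (\dim K - w < s)%N by dlia.
  rewrite (_ : _ + _ - 1 = d - 2 * s - 2)%N; last by dlia.
  move=> /(_ ltac:(dlia) ltac:(dlia) ltac:(dlia) ltac:(dlia)) h'.
  by have := leq_sub2r (1 * (d - 2 * s - 2)) h'; rewrite addnK mul1n.
have lec : {in intervalv A y1 (d - t + s)%N, forall X,
    (#|[set z in Y | (d - t + s <= \dim (z :&: proj X y2))%N]|
       <= 2 * Q ^ 3 * q ^ e2 * opp_count s.+1 +
          Q * q ^ s.+1 * (2 * Q ^ 3 * q ^ e3 * opp_count s))%N}.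
  move=> X /intervalvP[_ sXy1 _]; have XP := polarS PG (YP y1Y) sXy1.
  set U := proj X y2; have Ug : U \in gens by apply: (proj_gen PG) => //; apply: Yg.
  have UP := gen_polar PG Ug; have dU := gen_dim PG Ug.
  have [y yY ltk] := noU U Ug; set K := (U :&: y)%VS in ltk.
  have triple z : z \in Y -> (d - s.+1 <= \dim (z :&: U))%N ->
      (\dim K + \dim (z :&: U) + \dim (z :&: y) <= d + 2 * \dim (z :&: K))%N.
    by move=> zY _; apply: (dim_triple PG) => //; apply: YP.
  rewrite tsE; set C := [set z in Y | _].
  (* Split by whether [z :&: K] has codimension below [s] in [K]; this condition is the second entry
     of the maximum in [w]. *)
  rewrite -(cardsID [set z in Y | (\dim K < s + \dim (z :&: K))%N] C).
  apply: leq_add.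
    have [w wE] : exists w, w = maxn (\dim K + d - 3 * s - 2).+1./2 ((\dim K).+1 - s).
      by eexists.
    have -> : opp_count s.+1 = opp_count (d - (d - s.+1)) by congr opp_count; dlia.
    apply: leq_trans (card_Y_small (e := e2) Ug (capvSl U y) (_ : w <= d - s.+1 <= d)%N _).
    - apply: subset_leq_card; apply/subsetP=> z; rewrite in_setI !in_set.
      case/andP=> /andP[zY lez] /andP[_ ltz]; rewrite zY lez /=.
      by have := triple z zY lez; have := Yt zY yY; rewrite -/K; dlia.
    - by dlia.
    rewrite -/K => lewK; rewrite (_ : d - (d - s.+1) = s.+1)%N; last by dlia.
    have := @exp_trade s.+1 (d - s.+1) w (\dim K - w) (s.+1 - (\dim K - w)) 2
       (d - 2 * s - 1 - (s.+1 - (\dim K - w))).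
    have h : (\dim K - w < s)%N by dlia.
    rewrite (_ : _ + _ - 2 = d - 2 * s - 3)%N; last by dlia.
    move=> /(_ ltac:(dlia) ltac:(dlia) ltac:(dlia) ltac:(dlia)) h'.
    by have := leq_sub2r (2 * (d - 2 * s - 3)) h'; rewrite addnK.
  (* Codimension at least [s] is compatible with [dim_triple] only if [K] has the largest dimension
     left by [ltk]. *)
  case: (eqVneq (\dim K) (d - s.+2)%N) => dK; last first.
    rewrite (_ : C :\: _ = set0) ?cards0 //.
    apply/setP=> z; rewrite in_setD !in_set; apply/negbTE/negP => /andP[+ /andP[zY lez]].
    rewrite zY /= -leqNgt => le; move/eqP: dK; apply.
    by have := triple z zY lez; have := Yt zY yY; dlia.
  have sizeH : (#|intervalv K U d.-1| <= Q * q ^ s.+1)%N.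
    rewrite card_intervalv ?capvSl ?dU ?leq_pred // dK.
    have -> : (d - (d - s.+2) = s.+2)%N by dlia.
    have -> : (d - d.-1 = 1)%N by dlia.
    by have := @gbin_ub q q_gt1 s.+2 1 isT; rewrite mul1n subSS subn0.
  apply: leq_trans (leq_mul sizeH (leqnn _)).
  apply: (@card_cover_leq _ _ _ _ (fun H => [set z in Y | (d - s <= \dim (z :&: proj H y))%N])).
    move=> z; rewrite in_setD !in_set => /andP[+ /andP[zY lez]].
    rewrite zY /= -leqNgt => le.
    have := triple z zY lez => tz; have tzy := Yt zY yY.
    (* [dim_triple] is now tight, which fixes all three dimensions. *)
    have dzK : \dim (z :&: K) = (d - 2 * s - 2)%N by dlia.
    have dzU : \dim (z :&: U) = (d - s.+1)%N by dlia.
    have dzy : \dim (z :&: y) = (d - 2 * s - 1)%N by dlia.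
    have KzU : (K :&: (z :&: U))%VS = (z :&: K)%VS.
      apply/eqP; rewrite eqEsubv; apply/andP; split; rewrite subv_cap.
        by rewrite capvSl (subv_trans (capvSr _ _)) ?capvSl.
      by rewrite capvSr subv_cap capvSl (subv_trans (capvSr _ _)) ?capvSl.
    (* A hyperplane [H] of [U] for which [proj H y] contains both [z :&: U] and [z :&: y]. *)
    exists (K + (z :&: U))%VS.
      apply/intervalvP; split; rewrite ?addvSl ?subv_add ?capvSl ?capvSr //.
      by have := dimv_sum_cap K (z :&: U); rewrite KzU; dlia.
    rewrite in_set zY /=; set H := (K + (z :&: U))%VS.
    have s1 : ((z :&: U) + (z :&: y) <= z :&: proj H y)%VS.
      rewrite subv_cap !subv_add !capvSl /=; apply/andP; split.
        by rewrite (subv_trans _ (addvSl _ _)) // addvSr.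
      rewrite (subv_trans _ (addvSr _ _)) // subv_cap capvSr /=.
      rewrite (perpC PG) subv_add; apply/andP; split.
        by apply: (polar_sub_perp PG (YP yY)); rewrite capvSr.
      by apply: (polar_sub_perp PG (YP zY)); rewrite ?capvSl.
    have s2 : ((z :&: U) :&: (z :&: y) <= z :&: K)%VS.
      rewrite subv_cap (subv_trans (capvSl _ _)) ?capvSl //= subv_cap.
      by rewrite (subv_trans (capvSl _ _)) ?capvSr //= (subv_trans (capvSr _ _)) ?capvSr.
    have := dimvS s1; have := dimvS s2; have := dimv_sum_cap (z :&: U) (z :&: y); dlia.
  move=> H /intervalvP[_ sHU _]; apply: lec3.
  by apply: (proj_gen PG); rewrite ?Yg //; apply: (polarS PG UP).
have := card_Y_split lec; rewrite s_gt0 mul1n.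
rewrite (_ : (t - s) * s = s.+1 * s)%N; last by rewrite t2s; congr (_ * _)%N; dlia.
rewrite mulnDr addnA.
set S1 := (_ * opp_count t)%N; set S2 := (_ * (_ * opp_count s.+1))%N.
set S3 := (_ * (_ * (_ * opp_count s)))%N => leY.
have o0 := opp_count_gt0 s.+1; have Q2 := qconst_gt1.
have big_d' : large_rank (2 * s).+1 kp d by rewrite -t2s.
have lt1 : (3 * S1 < q ^ (s * (d - s.+1)) * opp_count s.+1)%N.
  have := opp_count_leq s.+1 s; rewrite (_ : s.+1 + s = t)%N; last by dlia.
  move=> h; apply: leq_ltn_trans (_ : 3 * (2 * Q ^ 3 *
     q ^ (s.-1 * (d - t - s).+1 + t * s.-1) * (q ^ (s.+1 * s + 'C(s, 2) + 3 * s) * opp_count s.+1)) < _)%N.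
    by rewrite leq_mul // leq_mul.
  rewrite (_ : 3 * _ = 6 * Q ^ 3 * q ^ (s.-1 * (d - t - s).+1 + t * s.-1 +
      (s.+1 * s + 'C(s, 2) + 3 * s)) * opp_count s.+1)%N; last first.
    by rewrite (expnD q (_ + t * s.-1)); clear; lia.
  apply: small_lt => //; first by rewrite leq_mul // leq_pexp2l // ltnW.
  by rewrite t2s; apply: exp_odd_excess.
have lt2 : (3 * S2 < q ^ (s * (d - s.+1)) * opp_count s.+1)%N.
  rewrite /S2 (_ : 3 * _ = 6 * Q ^ 4 * q ^ (s.+1 * s + e2) * opp_count s.+1)%N; last first.
    by rewrite expnD (expnS Q 3); clear; lia.
  apply: small_lt => //; first by rewrite leq_mul // leq_pexp2l // ltnW.
  exact: exp_odd_proj.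
have lt3 : (3 * S3 < q ^ (s * (d - s.+1)) * opp_count s.+1)%N.
  apply: leq_ltn_trans (_ : 6 * Q ^ 5 * q ^ (s.+1 * s + s.+1 + e3) * opp_count s.+1 < _)%N.
    rewrite /S3 (_ : 3 * _ = 6 * Q ^ 5 * q ^ (s.+1 * s + s.+1 + e3) * opp_count s)%N; last first.
      by rewrite !expnD (expnS Q 4) (expnS Q 3); clear; lia.
    by rewrite leq_mul // opp_count_mono.
  by apply: small_lt => //; apply: exp_odd_proj2.
exact: third_sum_lt leY lt1 lt2 lt3.
Qed.

End Pair.
End FixedFamily.
End LargeEKR.

(** * Comparison with the examples *)

Section MaximalEKR.
Variables (F : finFieldType) (V : vectType F).
Variables (P : {set {vspace V}}) (perp : {vspace V} -> {vspace V}).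
Hypothesis PG : polar_geometry P perp.
Implicit Types (U W X y z g H K A : {vspace V}) (Y : {set {vspace V}}).
Local Notation q := #|F|.
Local Notation d := (polar_rank P).
Local Notation gens := (generators P).
Local Notation Q := (qconst q).
Local Notation gmeet := (generators_meeting P).

Let q_gt1 : (1 < q)%N. Proof. exact: card_finNzRing_gt1. Qed.

Variable E : nat.
Hypothesis card_gens_hyper : forall H, H \in P -> (\dim H).+1 = d ->
  #|gens_on P H| = E.+1.
Hypothesis E_gt0 : (0 < E)%N.
Hypothesis E_leq : few_gens F E.

Local Notation opp_count := (opp_count F E).

Lemma in_gmeet U k z : (z \in gmeet U k) = (z \in gens) && (k <= \dim (z :&: U))%N.
Proof. by rewrite in_set. Qed.

Lemma dim_cap_hyper U W z : (U <= W)%VS -> \dim W = (\dim U).+1 ->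
  (\dim (z :&: W) <= (\dim (z :&: U)).+1)%N.
Proof.
move=> sUW dW.
have e : (z :&: W :&: U)%VS = (z :&: U)%VS.
  by rewrite -capvA (capv_idPr sUW).
have s : (z :&: W + U <= W)%VS by rewrite subv_add capvSr.
by have := dimvS s; have := dimv_sum_cap (z :&: W) U; rewrite e dW; lia.
Qed.

Lemma card_gmeet_even_geq U s : U \in gens -> (s <= d)%N ->
  (q ^ (s * (d - s)) * opp_count s <= #|gmeet U (d - s)|)%N.
Proof.
move=> Ug sd; have dU := gen_dim PG Ug.
apply: leq_trans (_ : #|[set z in gens | (z :&: U)%VS \in intervalv 0%VS U (d - s)]| <= _)%N.
  rewrite (card_gens_cap_in PG card_gens_hyper Ug (subvv U)) dU ?leq_subr // subKn //.
  by rewrite leq_mul2r gbin_lb ?orbT.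
apply: subset_leq_card; apply/subsetP=> z; rewrite in_set in_gmeet => /andP[-> /intervalvP[_ _ ->]].
exact: leqnn.
Qed.

(** The example on [U] contains all generators within distance [s] of [g], since passing from [g] to
    its hyperplane [U] costs at most one dimension, and those at distance [s.+1] whose trace on [g]
    lies in [U]. [odd_step] splits [Y] in the same way. *)
Lemma card_gmeet_hyper_geq g U s : g \in gens -> (U <= g)%VS -> (\dim U).+1 = d ->
  (s < d)%N ->
  (#|gmeet g (d - s)| + gbin q (\dim U) s * opp_count s.+1 <= #|gmeet U (d - s.+1)|)%N.
Proof.
move=> gg sUg dU sd; have dg := gen_dim PG gg.
have -> : (gbin q (\dim U) s * opp_count s.+1 =
    #|[set z in gens | (z :&: g)%VS \in intervalv 0%VS U (d - s.+1)]|)%N.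
  rewrite (card_gens_cap_in PG card_gens_hyper gg sUg) ?subKn //; last by lia.
  by congr (gbin _ _ _ * _)%N; lia.
rewrite -cardsUI (_ : _ :&: _ = set0) ?cards0 ?addn0; last first.
  apply/setP=> z; rewrite in_setI in_gmeet in_set in_set0; apply/negbTE/negP.
  by case/andP=> /andP[_ le] /andP[_ /intervalvP[_ _]]; lia.
apply: subset_leq_card; apply/subsetP=> z; rewrite in_setU !in_gmeet in_set.
case/orP=> /andP[-> /=].
  by have := @dim_cap_hyper U g z sUg; rewrite dg -dU => /(_ erefl); lia.
case/intervalvP=> _ sU <-; apply: dimvS.
by rewrite subv_cap capvSl.
Qed.

Lemma card_gmeet_odd_geq U s : U \in P -> (\dim U).+1 = d -> (s < d)%N ->
  (q ^ (s * (d - s.+1)) * opp_count s.+1 <= #|gmeet U (d - s.+1)|)%N.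
Proof.
move=> UP dU sd; have [g gg sUg] := polar_in_gen PG UP.
apply: leq_trans (card_gmeet_hyper_geq gg sUg dU sd).
apply: leq_trans (leq_addl _ _); rewrite leq_mul2r.
have := @gbin_lb _ q_gt1 (\dim U) s; rewrite (_ : \dim U - s = d - s.+1)%N; last by lia.
by move=> ->; rewrite ?orbT //; lia.
Qed.

Section FixedFamily.
Variables (t kp : nat) (Y : {set {vspace V}}).
Hypothesis kpP : const_absorbed F kp.
Hypothesis sYg : Y \subset gens.
Hypothesis Yt : {in Y &, forall y1 y2, (d - t <= \dim (y1 :&: y2))%N}.

Let Yg y : y \in Y -> y \in gens. Proof. exact: subsetP. Qed.
Let YP y : y \in Y -> y \in P. Proof. by move/Yg/(gen_polar PG). Qed.

(** * Odd distance: from a generator close to all members to one of its hyperplanes *)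

Section OddStep.
Variables (g : {vspace V}) (s : nat).
Hypotheses (gg : g \in gens) (t2s : t = (2 * s).+1).
Hypothesis Yg1 : {in Y, forall y, (d - s.+1 <= \dim (y :&: g))%N}.
Hypothesis led : (3 * s + 2 <= d)%N.

Let dg : \dim g = d. Proof. exact: (gen_dim PG). Qed.

(** Only the traces of least dimension matter: a member with a larger trace meets every hyperplane
    of [g] in sufficient dimension. *)
Definition traces : {set {vspace V}} :=
  [set (y :&: g)%VS | y in [set y in Y | \dim (y :&: g) == (d - s.+1)%N]].

Lemma tracesP K : reflect (exists y, [/\ y \in Y, \dim K = (d - s.+1)%N & K = (y :&: g)%VS])
  (K \in traces).
Proof.
apply: (iffP imsetP) => [[y]|[y [yY dK KE]]].
  by rewrite in_set => /andP[yY /eqP dy] ->; exists y.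
by exists y; rewrite ?in_set ?yY -?KE ?dK ?eqxx.
Qed.

(* In the dual of [g] the traces form an intersecting family. *)
Lemma traces_sum_hyper K K' : K \in traces -> K' \in traces ->
  exists2 U, U \in intervalv K g d.-1 & (K' <= U)%VS.
Proof.
case/tracesP=> y [yY dK KE] /tracesP[y' [yY' dK' KE']].
have tr := dim_triple PG (gen_polar PG gg) (YP yY) (YP yY').
have e1 : (g :&: y)%VS = K by rewrite capvC.
have e2 : (y' :&: K)%VS = (K :&: K')%VS.
  have sKg : (K <= g)%VS by rewrite KE capvSr.
  by rewrite KE' [(y' :&: g)%VS]capvC capvA (capv_idPl sKg) capvC.
have := Yt yY' yY; move: tr; rewrite e1 e2 -KE' dK dK' => tr ty.
have sKK : (K + K' <= g)%VS by rewrite subv_add KE KE' !capvSr.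
(* As [t] is odd, rounding in [dim_triple] gives [\dim (K :&: K') >= d - 2 * s - 1], so [K + K'] is
   proper in [g]. *)
have [|U [sU sUg dU]] := @subv_between _ _ (K + K')%VS g d.-1 sKK.
  have := dimv_sum_cap K K'; rewrite dg; move: tr ty led; rewrite t2s dK dK'.
  by clear; lia.
exists U; last exact: subv_trans (addvSr _ _) sU.
by apply/intervalvP; split=> //; apply: subv_trans (addvSl _ _) sU.
Qed.

Lemma traces_in_hyper U : (U <= g)%VS -> (\dim U).+1 = d ->
  {in traces, forall K, (K <= U)%VS} -> {in Y, forall y, (d - s.+1 <= \dim (y :&: U))%N}.
Proof.
move=> sUg dU trU y yY; have le := Yg1 yY.
have [eqd|neqd] := eqVneq (\dim (y :&: g)) (d - s.+1)%N.
  rewrite -eqd; apply: dimvS; rewrite subv_cap capvSl; apply: trU.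
  by apply/tracesP; exists y.
have := @dim_cap_hyper U g y sUg; rewrite dg -dU => /(_ erefl).
by move/eqP: neqd le; rewrite -dU; clear; lia.
Qed.

(** Every trace lies in a hyperplane [U] on a fixed trace [K1]. Some trace [K2] is outside [U], and
    each trace in [U] also lies in a hyperplane [U'] on [K2], hence in [U :&: U'], of dimension
    $d-2$. *)
Lemma few_traces : (0 < s)%N ->
    (forall U, U \in intervalv 0%VS g d.-1 -> exists2 K, K \in traces & ~~ (K <= U)%VS) ->
  (#|traces| <= gbin q s.+1 1 * (gbin q s.+1 1 * gbin q d.-2 s.-1))%N.
Proof.
move=> s_gt0 noU.
have [U0 [_ sU0 dU0]] := @subv_between _ _ 0%VS g d.-1 (sub0v _) ltac:(by rewrite dimv0 dg leq_pred).
have [|K1 K1T _] := noU U0; first by apply/intervalvP; split=> //; apply: sub0v.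
have card_hyp K : K \in traces -> #|intervalv K g d.-1| = gbin q s.+1 1.
  case/tracesP=> y [yY dK KE]; have sKg : (K <= g)%VS by rewrite KE capvSr.
  rewrite card_intervalv ?dg ?leq_pred // dK.
  by congr (gbin _ _ _); move: led; clear; lia.
rewrite -{1}(card_hyp _ K1T).
apply: (@card_cover_leq _ _ _ _ (fun U => [set K in traces | (K <= U)%VS])) => [K KT|U].
  have [U UI sKU] := traces_sum_hyper K1T KT.
  by exists U; rewrite // in_set KT.
case/intervalvP=> _ sUg dU.
have [|K2 K2T nK2] := noU U; first by apply/intervalvP; split=> //; apply: sub0v.
rewrite -(card_hyp _ K2T).
apply: (@card_cover_leq _ _ _ _ (fun U' => intervalv 0%VS (U :&: U')%VS (d - s.+1)%N)).
  move=> K; rewrite in_set => /andP[KT sKU].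
  have [U' UI' sKU'] := traces_sum_hyper K2T KT.
  exists U' => //; apply/intervalvP; rewrite sub0v subv_cap sKU sKU'; split=> //.
  by case/tracesP: KT => y [].
move=> U' /intervalvP[sK2 sUg' dU'].
have dUU : \dim (U :&: U') = d.-2.
  have nUU : ~~ (U' <= U)%VS by apply: contra nK2; apply: subv_trans.
  have /subvPn[x xU' xU] := nUU.
  have s1 : (U + <[x]> <= U + U')%VS by rewrite addvS // -memvE.
  have s2 : (U + U' <= g)%VS by rewrite subv_add sUg.
  have := dimvS s1; have := dimvS s2; rewrite dimv_add_line // dg.
  by have := dimv_sum_cap U U'; rewrite dU dU'; move: led; clear; lia.
rewrite card_intervalv ?sub0v ?dimv0 ?subn0 ?dUU //; last by move: led s_gt0; clear; lia.
by rewrite (_ : d.-2 - (d - s.+1) = s.-1)%N //; move: led s_gt0; clear; lia.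
Qed.

Lemma odd_step : large_rank t kp d ->
  exists U, [/\ U \in P, (\dim U).+1 = d &
    {in Y, forall y, (d - s.+1 <= \dim (y :&: U))%N} \/
    (#|Y| < #|gmeet U (d - s.+1)|)%N].
Proof.
move=> big_d.
have hypP U : U \in intervalv 0%VS g d.-1 -> [/\ (U <= g)%VS, U \in P & (\dim U).+1 = d].
  case/intervalvP=> _ sUg dU; split=> //; first exact: (polarS PG (gen_polar PG gg)).
  by rewrite dU; move: led; clear; lia.
case: (boolP [exists U in intervalv 0%VS g d.-1, [forall K in traces, (K <= U)%VS]]).
  case/exists_inP=> U /hypP[sUg UP dU] /forall_inP trU; exists U; split=> //.
  by left; apply: traces_in_hyper.
rewrite negb_exists_in => /forall_inP noU.
have {}noU U : U \in intervalv 0%VS g d.-1 -> exists2 K, K \in traces & ~~ (K <= U)%VS.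
  by move/noU; rewrite negb_forall_in => /exists_inP[K KT nK]; exists K.
have [U0 [_ sU0 dU0]] := @subv_between _ _ 0%VS g d.-1 (sub0v _) ltac:(by rewrite dimv0 dg leq_pred).
have U0I : U0 \in intervalv 0%VS g d.-1 by apply/intervalvP; split=> //; apply: sub0v.
have [_ U0P dU0'] := hypP _ U0I.
(* For [s = 0] the traces are hyperplanes of [g]; two of them inside a common hyperplane coincide,
   contrary to [noU]. *)
have s_gt0 : (0 < s)%N.
  rewrite lt0n; apply/eqP=> s0.
  have [K1 K1T _] := noU _ U0I.
  have dT K : K \in traces -> (K <= g)%VS /\ \dim K = d.-1.
    case/tracesP=> y [_ -> ->]; rewrite capvSr; split=> //.
    by rewrite s0; move: led; clear; lia.
  have [sK1g dK1] := dT _ K1T.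
  have [|K2 K2T] := noU K1; first by apply/intervalvP; rewrite sub0v.
  have [U /intervalvP[sKU sUg dU] sK2U] := traces_sum_hyper K1T K2T.
  by rewrite (subv_dim_eq sKU) ?sK2U // dU dK1.
exists U0; split=> //; right.
apply: leq_trans (card_gmeet_hyper_geq gg sU0 dU0' _); last by move: led; clear; lia.
(* Members with a larger trace are among the first summand of [card_gmeet_hyper_geq]; the strict
   inequality comes from the others. *)
rewrite -(cardsID [set y in Y | \dim (y :&: g) == (d - s.+1)%N] Y) addnC -addnS.
apply: leq_add.
  apply: subset_leq_card; apply/subsetP=> y; rewrite in_setD in_gmeet in_set => /andP[ny yY].
  rewrite Yg //=; move: ny; rewrite yY /= => /eqP; have := Yg1 yY; clear; lia.
apply: leq_ltn_trans (_ : #|traces| * opp_count s.+1 < _)%N.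
  apply: (@card_cover_leq _ _ _ _ (fun K => [set z in gens | (z :&: g)%VS == K])) => [y|K].
    rewrite in_setI in_set => /andP[_ /andP[yY /eqP dy]].
    exists (y :&: g)%VS; first by apply/tracesP; exists y.
    by rewrite in_set eqxx Yg.
  case/tracesP=> y [_ dK KE]; have sKg : (K <= g)%VS by rewrite KE capvSr.
  rewrite (card_gens_meet PG card_gens_hyper gg sKg) dK subKn //.
  by move: led; clear; lia.
rewrite ltn_pmul2r ?opp_count_gt0 //.
apply: leq_ltn_trans (few_traces s_gt0 noU) _.
have -> : \dim U0 = d.-1 by [].
apply: leq_trans (gbin_lb q_gt1 (_ : s <= d.-1)%N); last by move: led; clear; lia.
have h1 : (gbin q s.+1 1 <= Q * q ^ s)%N.
  by have := @gbin_ub q q_gt1 s.+1 1 isT; rewrite mul1n subSS subn0.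
have h2 : (gbin q d.-2 s.-1 <= Q * q ^ (s.-1 * (d - s.+1)))%N.
  have := @gbin_ub q q_gt1 d.-2 s.-1; rewrite (_ : d.-2 - s.-1 = d - s.+1)%N.
    by apply; move: led; clear; lia.
  by move: led s_gt0; clear; lia.
apply: leq_ltn_trans (leq_mul h1 (leq_mul h1 h2)) _.
rewrite (_ : (_ * _)%N = (Q ^ 3 * q ^ (s + s + s.-1 * (d - s.+1)))%N); last first.
  by rewrite !expnD !expnS expn0; clear; lia.
apply: (exp_lt (kp := kp)).
  apply: leq_ltn_trans kpP; rewrite -[X in (X <= _)%N]mul1n leq_mul // leq_pexp2l //.
  by rewrite ltnW // qconst_gt1.
have := large_rank_geq (_ : 2 * s <= t)%N s_gt0 big_d; rewrite t2s => /(_ (leqnSn _)) led'.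
have bd : (s + s + kp <= d - s.+1)%N.
  have := large_rankE big_d; rewrite t2s; move: led' s_gt0 (leq_pmull s s_gt0); clear; lia.
have -> : (d.-1 - s = d - s.+1)%N by move: led; clear; lia.
have -> : (s * (d - s.+1) = (d - s.+1) + s.-1 * (d - s.+1))%N.
  by case: (s) s_gt0 => // s' _; rewrite mulSn.
by move: bd; clear; lia.
Qed.

End OddStep.

(** The forms [d - odd t] and [d - t.+1./2] describe the examples of both parities at once. *)
Lemma pair_case y1 y2 : y1 \in Y -> y2 \in Y -> \dim (y1 :&: y2) = (d - t)%N ->
    large_rank t kp d ->
  exists U, [/\ U \in P, \dim U = (d - odd t)%N &
    {in Y, forall y, (d - t.+1./2 <= \dim (y :&: U))%N} \/
    (#|Y| < #|gmeet U (d - t.+1./2)|)%N].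
Proof.
move=> y1Y y2Y dA big_d.
have led : (3 * t <= d)%N.
  have := large_rankE big_d; have : (t + t <= t * t + 1)%N by clear; nia.
  by clear; lia.
have le1 : (5 * t + 3 <= 2 * d)%N.
  have := large_rankE big_d; have : (t + t <= t * t + 1)%N by clear; nia.
  by clear; lia.
have y1g := Yg y1Y; have dy1 := gen_dim PG y1g.
case: (boolP (odd t)) => [odd_t | even_t].
  have [s t2s] : exists s, t = (2 * s).+1 by exists t./2; rewrite -{1}(odd_double_half t) odd_t; clear; lia.
  have -> : t.+1./2 = s.+1 by rewrite t2s; clear; lia.
  have leds : (3 * s + 2 <= d)%N by move: led le1; rewrite t2s; clear; lia.
  have step g : g \in gens -> {in Y, forall y, (d - s.+1 <= \dim (y :&: g))%N} ->
      exists U, [/\ U \in P, \dim U = (d - 1)%N &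
      {in Y, forall y, (d - s.+1 <= \dim (y :&: U))%N} \/
      (#|Y| < #|gmeet U (d - s.+1)|)%N].
    move=> gg Yg1; have [U [UP dU YU]] := odd_step gg t2s Yg1 leds big_d.
    by exists U; split=> //; rewrite -dU subn1.
  case: (posnP s) => [s0|s_gt0].
    (* For [t = 1], [y1] itself is a generator close to all of [Y]. *)
    apply: (step y1) => // y yY; rewrite s0.
    by have := Yt yY y1Y; rewrite t2s s0.
  have tE : t./2 = s by rewrite t2s; clear; lia.
  have [[g gg Yg1]|small] :=
    odd_dichotomy PG card_gens_hyper E_gt0 E_leq kpP sYg Yt y1Y y2Y dA led tE t2s s_gt0 big_d.
    exact: (step g).
  have [U [_ sU dU]] := @subv_between _ _ 0%VS y1 d.-1 (sub0v _) ltac:(by rewrite dimv0 dy1 leq_pred).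
  have UP : U \in P by apply: (polarS PG (YP y1Y)).
  exists U; split=> //; first by rewrite dU subn1.
  right; apply: leq_trans small (card_gmeet_odd_geq UP _ _).
    by rewrite dU; move: leds; clear; lia.
  by move: leds; clear; lia.
have [s t2s] : exists s, t = (2 * s)%N by exists t./2; rewrite -{1}(odd_double_half t) (negPf even_t); clear; lia.
have -> : t.+1./2 = s by rewrite t2s; clear; lia.
case: (posnP s) => [s0|s_gt0].
  exists y1; rewrite subn0; split=> //; first exact: YP.
  by left=> y yY; rewrite s0; have := Yt yY y1Y; rewrite t2s s0.
have tE : t./2 = s by rewrite t2s; clear; lia.
have [[g gg Yg1]|small] :=
  even_dichotomy PG card_gens_hyper E_gt0 E_leq kpP sYg Yt y1Y y2Y dA led tE t2s s_gt0 big_d.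
  by exists g; rewrite subn0; split; [apply: (gen_polar PG) | apply: (gen_dim PG) | left].
exists y1; rewrite subn0; split=> //; first exact: YP.
right; apply: leq_trans small (card_gmeet_even_geq y1g _).
by move: led; rewrite t2s; clear; lia.
Qed.

End FixedFamily.

(** For odd [t] the subspace grows to a generator and the threshold stays; for even [t] it shrinks
    to a hyperplane, which costs one dimension, and the threshold drops by one. *)
Lemma gmeet_next t U : (t < d)%N -> U \in P -> \dim U = (d - odd t)%N ->
  exists U', [/\ U' \in P, \dim U' = (d - odd t.+1)%N &
    gmeet U (d - t.+1./2) \subset gmeet U' (d - t.+2./2)].
Proof.
move=> td UP dU; case: (boolP (odd t)) dU => [odd_t|even_t] dU.
  have [g gg sUg] := polar_in_gen PG UP; exists g; rewrite oddS odd_t subn0.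
  split; [exact: gen_polar PG _ gg | exact: gen_dim PG _ gg | ].
  apply/subsetP=> z; rewrite !in_gmeet => /andP[-> le]; rewrite andTb.
  apply: leq_trans (dimvS (capvS (subvv z) sUg)); apply: leq_trans le.
  by apply: leq_sub2l; apply: (@half_leq t.+1 t.+2).
rewrite subn0 in dU.
have [U' [_ sU dU']] := @subv_between _ _ 0%VS U d.-1 (sub0v _) ltac:(by rewrite dimv0 dU leq_pred).
exists U'; rewrite oddS even_t subn1; split=> //; first exact: (polarS PG UP).
apply/subsetP=> z; rewrite !in_gmeet => /andP[-> le]; rewrite andTb.
have := @dim_cap_hyper U' U z sU; rewrite dU dU'.
have et : (t.+2./2 = t.+1./2.+1)%N.
  by have := odd_double_half t; rewrite (negPf even_t); clear; lia.
by move=> /(_ ltac:(by move: td; clear; lia)); move: le; rewrite et; clear; lia.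
Qed.

(** Induction on [t]: if the distance [t] is not attained in [Y], the result for [t - 1] applies and
    [gmeet_next] carries it over. For [t = 0] the pair is [y], [y]. *)
Theorem EKR_bound t kp Y : const_absorbed F kp -> large_rank t kp d ->
    Y \subset gens -> {in Y &, forall y1 y2, (d - t <= \dim (y1 :&: y2))%N} ->
    Y != set0 ->
  exists U, [/\ U \in P, \dim U = (d - odd t)%N &
    Y \subset gmeet U (d - t.+1./2) \/ (#|Y| < #|gmeet U (d - t.+1./2)|)%N].
Proof.
move=> kpP; elim: t => [|t IH] big_d sYg Yt Y0; last first.
  case: (boolP [exists y1 in Y, [exists y2 in Y, \dim (y1 :&: y2) == (d - t.+1)%N]]).
    case/exists_inP=> y1 y1Y /exists_inP[y2 y2Y /eqP dA].
    have [U [UP dU YU]] := pair_case kpP sYg Yt y1Y y2Y dA big_d.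
    exists U; split=> //; case: YU => YU; [left | by right].
    by apply/subsetP=> y yY; rewrite in_gmeet YU ?(subsetP sYg).
  rewrite negb_exists_in => /forall_inP noP.
  have {}Yt : {in Y &, forall y1 y2, (d - t <= \dim (y1 :&: y2))%N}.
    move=> y1 y2 y1Y y2Y; have := noP y1 y1Y; rewrite negb_exists_in.
    by move/forall_inP/(_ y2 y2Y)/eqP; have := Yt y1 y2 y1Y y2Y; clear; lia.
  have big_d' : large_rank t kp d.
    by case: big_d => -[-> h]; [left | right]; split=> //; move: h; rewrite !expnS expn0; clear; lia.
  have [U [UP dU YU]] := IH big_d' sYg Yt Y0.
  have td : (t < d)%N by have := large_rankE big_d; clear; nia.
  have [U' [UP' dU' sUU']] := gmeet_next td UP dU.
  exists U'; split=> //; case: YU => YU; [left | right].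
    exact: subset_trans sUU'.
  exact: leq_trans YU (subset_leq_card sUU').
have [y yY] := set0Pn _ Y0; have yg := subsetP sYg _ yY.
have dA : \dim (y :&: y) = (d - 0)%N by rewrite capvv (gen_dim PG yg) subn0.
have [U [UP dU YU]] := pair_case kpP sYg Yt yY yY dA big_d.
exists U; split=> //; case: YU => YU; [left | by right].
by apply/subsetP=> z zY; rewrite in_gmeet YU ?(subsetP sYg).
Qed.

End MaximalEKR.

(** * Forms and transitivity *)

Section LinearMaps.
Variables (F : fieldType) (V W : vectType F).

Lemma linfunE (h : V -> W) : linear h -> linfun h =1 h.
Proof.
move=> hl; pose h' : {linear V -> W} := HB.pack h (GRing.isLinear.Build _ _ _ _ h hl).
exact: (lfunE h').
Qed.

End LinearMaps.

(* [pf_swap] is about the map [x |-> x + f x w / f u u' *: w] with [w = u' - u]: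
   a transvection in the symplectic case, a reflection in the orthogonal case,
   a quasi-reflection in the hermitian case; it maps [u] to [u']. *)
Record polar_space_form (F : finFieldType) (V : vectType F)
    (f : V -> V -> F) (iso : pred V) (P : {set {vspace V}}) : Prop :=
  PolarSpaceForm {
    pf_linl : forall v a x y, f (a *: x + y) v = a * f x v + f y v;
    pf_subr : forall u x y, f u (x - y) = f u x - f u y;
    pf_sym : forall u v, f u v = 0 -> f v u = 0;
    pf_iso0 : iso 0;
    pf_isoZ : forall a v, iso v -> iso (a *: v);
    pf_isoD : forall u v, iso u -> iso v -> f u v = 0 -> iso (u + v);
    pf_self : forall v, iso v -> f v v = 0;
    pf_mem : forall U, U \in P <->
      {in U, forall u, iso u} /\ {in U &, forall u v, f u v = 0};
    pf_nondeg : forall v, iso v -> (forall u, f u v = 0) -> v = 0;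
    pf_hyper : forall p v, iso p -> f v p != 0 -> exists a, iso (v + a *: p);
    pf_aniso : forall U, (2 < \dim U)%N -> exists v, [/\ v \in U, iso v & v != 0];
    pf_swap : forall u u' (g := fun x => x + (f x (u' - u) / f u u') *: (u' - u)),
      iso u -> iso u' -> f u u' != 0 ->
      (forall x, iso x -> iso (g x)) /\
      (forall x y, f x y = 0 -> f (g x) (g y) = 0) }.

Section PolarSpaceForm.
Variables (F : finFieldType) (V : vectType F).
Variables (f : V -> V -> F) (iso : pred V) (P : {set {vspace V}}).
Hypothesis PF : polar_space_form f iso P.
Implicit Types (U W X H : {vspace V}) (u v w x p : V).
Local Notation q := #|F|.
Local Notation d := (polar_rank P).
Local Notation gens := (generators P).

Let q_gt1 : (1 < q)%N. Proof. exact: card_finNzRing_gt1. Qed.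

Lemma formDl x y v : f (x + y) v = f x v + f y v.
Proof. by have := pf_linl PF v 1 x y; rewrite scale1r mul1r. Qed.

Lemma form0l v : f 0 v = 0.
Proof. by apply: (addrI (f 0 v)); rewrite -formDl !addr0. Qed.

Lemma formZl a x v : f (a *: x) v = a * f x v.
Proof. by have := pf_linl PF v a x 0; rewrite !addr0 form0l addr0. Qed.

Lemma form_suml (I : Type) (r : seq I) (E : I -> V) v :
  f (\sum_(i <- r) E i) v = \sum_(i <- r) f (E i) v.
Proof.
elim: r => [|i r IH]; first by rewrite !big_nil form0l.
by rewrite !big_cons formDl IH.
Qed.

Lemma formC0 u v : (f u v == 0) = (f v u == 0).
Proof. by apply/eqP/eqP; apply: pf_sym PF _ _. Qed.

Definition form_lfun v : 'Hom(V, F^o) := linfun (fun x => f x v : F^o).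

Lemma form_lfunE v x : form_lfun v x = f x v.
Proof. by apply: (linfunE (h := fun x => f x v : F^o)) => a y z; exact: (pf_linl PF v a y z). Qed.

(** The varying vector stands on the left because linearity of [f] is assumed only there. *)
Definition perp_seq (s : seq V) : {vspace V} :=
  foldr (fun v X => lker (form_lfun v) :&: X)%VS fullv s.

Definition perp U := perp_seq (vbasis U).

Lemma perp_seqP s x : reflect {in s, forall v, f x v = 0} (x \in perp_seq s).
Proof.
elim: s => [|v s IH] /=; first by rewrite memvf; constructor.
rewrite memv_cap memv_ker form_lfunE; apply: (iffP andP) => [[/eqP xv /IH xs] w|xs].
  by rewrite inE => /predU1P[->|/xs].
split; first by rewrite xs ?mem_head.
by apply/IH => w ws; apply: xs; rewrite inE ws orbT.
Qed.

Lemma perpP U x : reflect {in U, forall u, f x u = 0} (x \in perp U).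
Proof.
apply: (iffP (perp_seqP _ _)) => [xb u uU|xU v vb]; last first.
  by apply/xU/vbasis_mem.
apply: (pf_sym PF); rewrite (coord_vbasis uU) form_suml big1 // => i _.
by rewrite formZl (pf_sym PF (xb _ _)) ?mulr0 // mem_nth ?size_tuple.
Qed.

Lemma sub_perpP U W : reflect {in U & W, forall u w, f u w = 0} (U <= perp W)%VS.
Proof.
apply: (iffP subvP) => [s u w uU wW|s u uU]; first by have /perpP := s u uU; apply.
by apply/perpP => w wW; apply: s.
Qed.

Lemma dim_cap_lker (g : 'Hom(V, F^o)) W : (\dim W <= (\dim (W :&: lker g)).+1)%N.
Proof.
have := limg_ker_dim g W; have := dimvS (subvf (g @: W)).
by rewrite dimvf /dim /=; lia.
Qed.

Lemma dim_cap_perp_seq s W : (\dim W <= \dim (W :&: perp_seq s) + size s)%N.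
Proof.
elim: s => [|v s IH] /=; first by rewrite capvf addn0.
have := dim_cap_lker (form_lfun v) (W :&: perp_seq s).
rewrite -capvA [(perp_seq s :&: _)%VS]capvC; lia.
Qed.

Lemma polarP U : reflect
  ({in U, forall u, iso u} /\ {in U &, forall u v, f u v = 0}) (U \in P).
Proof. by apply: (iffP idP) => /(pf_mem PF). Qed.

Lemma form_geometry : polar_geometry P perp.
Proof.
split.
- apply/polarP; split=> [u|u v]; rewrite memv0 => /eqP ->; first exact: pf_iso0 PF.
  by rewrite form0l.
- move=> U W /polarP[isoW oW] sUW; apply/polarP.
  by split=> [u /(subvP sUW)|u v /(subvP sUW) uW /(subvP sUW)]; [apply: isoW | apply: oW].
- move=> U W; apply/sub_perpP/sub_perpP => o u w uU wW; apply: (pf_sym PF); exact: o.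
- by move=> U /polarP[_ oU]; apply/sub_perpP.
- move=> U W /polarP[isoU oU] /polarP[isoW oW] /sub_perpP oUW.
  apply/polarP; split=> [_ /memv_addP[u uU [w wW ->]]|].
    by apply: (pf_isoD PF); [apply: isoU | apply: isoW | apply: oUW].
  move=> _ _ /memv_addP[u uU [w wW ->]] /memv_addP[u' uU' [w' wW' ->]].
  rewrite formDl (pf_sym PF (u := u' + w') (v := u)) ?add0r; last first.
    by rewrite formDl oU // (pf_sym PF (oUW _ _ _ _)) ?addr0.
  by apply: (pf_sym PF); rewrite formDl oUW // oW ?addr0.
- move=> U W; have := dim_cap_perp_seq (vbasis U) W.
  by rewrite size_tuple.
Qed.

Let PG := form_geometry.

(** Pairing with a basis of a complement of [perp U] is injective on [U], whose vectors are
    isotropic so that [pf_nondeg] applies. The dimensions are compared through cardinals since [f]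
    is only known to be additive on the right. *)
Lemma dim_perp_leq U : U \in P -> (\dim U + \dim (perp U) <= \dim {:V})%N.
Proof.
move=> UP; have /polarP[isoU oU] := UP.
pose C := (perp U)^C%VS.
have dC : (\dim (perp U) + \dim C = \dim {:V})%N.
  by rewrite /C dimv_compl subnKC // dimvS ?subvf.
pose phi (r : 'rV[F]_(\dim U)) : 'rV[F]_(\dim C) := \row_j f (vbasis C)`_j (vec_of r).
have phi_inj : injective phi.
  move=> r r' eq_phi; apply: vec_of_inj; apply/eqP; rewrite -subr_eq0; apply/eqP.
  have vU : vec_of r - vec_of r' \in U by rewrite rpredB ?vec_of_mem.
  apply: (pf_nondeg PF); first exact: isoU.
  move=> x; have : x \in (perp U + C)%VS by rewrite addv_complf memvf.
  case/memv_addP=> y /perpP yU [c cC ->]; rewrite formDl yU // add0r.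
  rewrite (coord_vbasis cC) form_suml big1 // => i _; rewrite formZl (pf_subr PF).
  by have /rowP/(_ i) := eq_phi; rewrite !mxE => ->; rewrite subrr mulr0.
have := leq_card phi phi_inj; rewrite !card_rV leq_exp2l //.
by lia.
Qed.

Lemma perp_proper X u : u \notin X -> (X + <[u]>)%VS \in P ->
  exists2 x, x \in perp X & f x u != 0.
Proof.
move=> uX XuP.
have : ~~ (perp X <= perp (X + <[u]>))%VS.
  apply/negP=> /dimvS; have := dim_perp_leq XuP; rewrite dimv_add_line //.
  by have := dim_cap_perp PG X fullv; rewrite capfv; lia.
case/subvPn=> x xX nx; exists x => //; apply: contra nx => /eqP xu.
apply/perpP=> _ /memv_addP[y yX [_ /vlineP[a ->] ->]]; apply: (pf_sym PF).
have /perpP/(_ y yX)/(pf_sym PF) yx := xX.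
by rewrite formDl formZl yx (pf_sym PF xu) mulr0 addr0.
Qed.

Lemma line_polar u : iso u -> <[u]>%VS \in P.
Proof.
move=> iu; apply/polarP; split=> [_ /vlineP[a ->]|_ _ /vlineP[a ->] /vlineP[b ->]].
  exact: (pf_isoZ PF).
by rewrite formZl (pf_sym PF) ?mulr0 // formZl (pf_self PF) ?mulr0.
Qed.

Lemma polar_add_line X u : X \in P -> iso u -> u \in perp X -> (X + <[u]>)%VS \in P.
Proof.
move=> XP iu uX; apply: (polarD PG) => //; first exact: line_polar.
by rewrite (perpC PG) -memvE.
Qed.

Lemma polar_split H U : (H <= U)%VS -> \dim U = (\dim H).+1 ->
  exists2 p, p \notin H & U = (H + <[p]>)%VS.
Proof.
move=> sHU dU; have /subvPn[p pU pH] : ~~ (U <= H)%VS by apply/negP=> /dimvS; lia.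
exists p => //; apply/esym/subv_dim_eq; rewrite ?dimv_add_line ?dU //.
by rewrite subv_add sHU -memvE.
Qed.

(** A vector of [perp H] not orthogonal to [p] becomes isotropic after adding a multiple of [p],
    which does not change its product with [p]. *)
Lemma isotropic_partner H p : p \notin H -> (H + <[p]>)%VS \in P ->
  exists w, [/\ iso w, w \in perp H & f w p != 0].
Proof.
move=> pH HpP; have /polarP[isoHp oHp] := HpP.
have pHp : p \in (H + <[p]>)%VS by rewrite memvE addvSr.
have [x xH xp] := perp_proper pH HpP.
have [a iw] := pf_hyper PF (isoHp p pHp) xp.
exists (x + a *: p); split=> //.
  rewrite rpredD // rpredZ //; apply/perpP=> h hH; apply: oHp => //.
  exact: subvP (addvSl _ _) _ hH.
by rewrite formDl formZl (oHp p p) // mulr0 addr0.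
Qed.

Lemma card_gens_on_gt1 H : H \in P -> (\dim H).+1 = d -> (1 < #|gens_on P H|)%N.
Proof.
move=> HP dH; have [U Ug sHU] := polar_in_gen PG HP.
have dU := gen_dim PG Ug; have UP := gen_polar PG Ug.
have [p pH UE] : exists2 p, p \notin H & U = (H + <[p]>)%VS.
  by apply: polar_split => //; rewrite dU.
have [w [iw wH wp]] := isotropic_partner pH (eq_ind _ (fun U => U \in P) UP _ UE).
have oH h : h \in H -> f h p = 0.
  move=> hH; have /polarP[_ oU] := UP; apply: oU; first exact: subvP sHU _ hH.
  by rewrite UE memvE addvSr.
have wnH : w \notin H by apply: contraNN wp => /oH ->.
have WP := polar_add_line HP iw wH.
have Wg : (H + <[w]>)%VS \in gens.
  by apply/(generatorsP PG); rewrite dimv_add_line.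
have neq : U != (H + <[w]>)%VS.
  apply: contraNneq wp => eqU; have /polarP[_ oU] := UP; apply/eqP/oU.
    by rewrite eqU memvE addvSr.
  by rewrite UE memvE addvSr.
apply: leq_trans (_ : #|[set U; (H + <[w]>)%VS]| <= _)%N; first by rewrite cards2 neq.
apply: subset_leq_card; apply/subsetP=> z; rewrite in_set2 in_gens_on.
by case/orP=> /eqP ->; rewrite ?Ug ?sHU ?Wg ?addvSl.
Qed.

(** [perp U] modulo [U] is anisotropic by maximality, hence of dimension at most 2, and at most 3
    modulo [H]. Each other generator on [H] contains some [v] with [f v p = 1]; two such vectors
    differ by an element of [perp U], and the class modulo [H] determines the generator. *)
Lemma card_gens_on_leq H : H \in P -> (\dim H).+1 = d ->
  (#|gens_on P H| <= (q ^ 3).+1)%N.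
Proof.
move=> HP dH; have [U Ug sHU] := polar_in_gen PG HP.
have dU := gen_dim PG Ug; have UP := gen_polar PG Ug.
have [p pH UE] : exists2 p, p \notin H & U = (H + <[p]>)%VS.
  by apply: polar_split => //; rewrite dU.
have pU : p \in U by rewrite UE memvE addvSr.
have /polarP[isoU oU] := UP.
have sUp : (U <= perp U)%VS := sub_perp PG UP.
pose C := (perp U :\: H)%VS.
have CH : (C + H)%VS = perp U.
  by rewrite addv_diff; apply/addv_idPl/(subv_trans sHU).
have dC : (\dim C <= 3)%N.
  have dCH : (\dim C + \dim H = \dim (perp U))%N.
    by rewrite -dimv_disjoint_sum ?CH // capv_diff.
  pose D := (perp U :\: U)%VS.
  have dD : (\dim D + \dim U = \dim (perp U))%N.
    rewrite -dimv_disjoint_sum ?capv_diff // addv_diff; congr (\dim _).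
    by apply/addv_idPl.
  suff : ~~ (2 < \dim D)%N by lia.
  apply/negP=> /(pf_aniso PF)[v [vD iv /negP]]; apply; rewrite -memv0.
  rewrite -(capv_diff (perp U) U) memv_cap vD /=.
  have vU : v \in perp U by apply: subvP vD; apply: diffvSl.
  have UvP := polar_add_line UP iv vU.
  have := addvSr U <[v]>; rewrite -(gen_eq PG Ug UvP (addvSl _ _)).
  by rewrite -memvE.
rewrite (cardsD1 U) in_gens_on Ug sHU add1n ltnS.
case: (set_0Vmem (gens_on P H :\ U)) => [->|[z0 z0A]]; first by rewrite cards0.
have good z : z \in gens_on P H :\ U -> exists2 v, v \in z & f v p = 1.
  rewrite in_setD1 in_gens_on => /and3P[nzU zg sHz].
  have /subvPn[v vz] : ~~ (z <= perp <[p]>)%VS.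
    apply: contraNN nzU => zp.
    have pz : p \in perp z by rewrite memvE (perpC PG).
    have zP := polar_add_line (gen_polar PG zg) (isoU p pU) pz.
    rewrite eq_sym; apply/eqP/(gen_eq PG Ug (gen_polar PG zg)).
    by rewrite UE subv_add sHz (gen_eq PG zg zP (addvSl _ _)) addvSr.
  move=> nv; have vp : f v p != 0.
    apply: contra nv => /eqP vp; apply/perpP=> _ /vlineP[a ->].
    by apply: (pf_sym PF); rewrite formZl (pf_sym PF vp) mulr0.
  by exists ((f v p)^-1 *: v); rewrite ?rpredZ // formZl mulVf.
have zH z v h : z \in gens_on P H :\ U -> v \in z -> h \in H -> f v h = 0.
  rewrite in_setD1 in_gens_on => /and3P[_ /(gen_polar PG)/polarP[_ oz] sHz] vz hH.
  by apply: oz => //; apply: subvP sHz _ hH.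
have [v0 v0z v0p] := good _ z0A.
apply: leq_trans (_ : q ^ \dim C * 1 <= _)%N; last first.
  by rewrite muln1 leq_pexp2l ?dC // ltnW.
rewrite -card_rV -cardsT.
apply: (@card_cover_leq _ _ _ _
  (fun r : 'rV[F]_(\dim C) => [set z in gens_on P H :\ U | v0 + vec_of r \in z])).
  move=> z zA; have [v vz vp] := good _ zA.
  have : v - v0 \in (C + H)%VS.
    rewrite CH; apply/perpP=> u; rewrite UE => /memv_addP[h hH [_ /vlineP[a ->] ->]].
    rewrite -[a *: p]opprK (pf_subr PF); apply/eqP; rewrite subr_eq0.
    have fB x : f (v - v0) x = f v x - f v0 x.
      by rewrite formDl -scaleN1r formZl mulN1r.
    rewrite fB (zH z) // (zH z0) // subrr eq_sym; apply/eqP/(pf_sym PF).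
    rewrite -scaleNr formZl (pf_sym PF (u := v - v0)) ?mulr0 //.
    by rewrite fB vp v0p subrr.
  case/memv_addP=> c cC [h hH vE]; have [r rE] := vec_of_surj cC.
  exists r; rewrite ?in_setT // in_set zA rE.
  have -> : v0 + c = v - h by rewrite -[v](subrK v0) vE [in RHS]addrAC addrK addrC.
  rewrite rpredB //; move: zA; rewrite in_setD1 in_gens_on => /and3P[_ _ sHz].
  exact: subvP sHz _ hH.
move=> r _; rewrite leqNgt; apply/negP=> /card_gt1P[z [z' [zI zI' neq]]].
move: zI; rewrite in_set => /andP[zA wz]; move: zI'; rewrite in_set => /andP[zA' wz'].
case/negP: neq; apply/eqP.
have wH : v0 + vec_of r \notin H.
  apply/negP=> wH; have /eqP := oU _ _ (subvP sHU _ wH) pU.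
  have /perpP/(_ p pU) rp : vec_of r \in perp U.
    by rewrite -CH; apply: subvP (addvSl _ _) _ (vec_of_mem r).
  by rewrite formDl v0p rp addr0 oner_eq0.
have zE y : y \in gens_on P H :\ U -> v0 + vec_of r \in y -> (H + <[v0 + vec_of r]>)%VS = y.
  rewrite in_setD1 in_gens_on => /and3P[_ yg sHy] wy; apply: subv_dim_eq.
    by rewrite subv_add sHy -memvE.
  by rewrite dimv_add_line // (gen_dim PG yg) dH.
exact: etrans (esym (zE z zA wz)) (zE z' zA' wz').
Qed.

(** * Transitivity on totally isotropic subspaces of a given dimension *)

Definition polar_linear_auto (g : 'End(V)) : Prop :=
  lker g == 0%VS /\ (forall U, U \in P -> (g @: U)%VS \in P).

Definition polar_conj U U' : Prop := exists2 g, polar_linear_auto g & (g @: U)%VS = U'.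

Lemma polar_conj_refl U : polar_conj U U.
Proof.
exists \1%VF; last by rewrite lim1g.
split; last by move=> W; rewrite lim1g.
by apply/lker0P=> x y; rewrite !id_lfunE.
Qed.

Lemma polar_conj_trans U1 U2 U3 : polar_conj U1 U2 -> polar_conj U2 U3 -> polar_conj U1 U3.
Proof.
move=> [g [gi gP] <-] [h [hi hP] <-]; exists (h \o g)%VF; last by rewrite limg_comp.
split; last by move=> U UP; rewrite limg_comp hP // gP.
move/lker0P: gi; move/lker0P: hi => hi gi.
by apply/lker0P=> x y; rewrite !comp_lfunE => /hi/gi.
Qed.

Lemma swap_conj H u u' : iso u -> iso u' -> f u u' != 0 -> H \in P ->
  u \in perp H -> u' \in perp H -> polar_conj (H + <[u]>) (H + <[u']>).
Proof.
move=> iu iu' uu' HP uH uH'; have [giso gorth] := pf_swap PF iu iu' uu'.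
set w := u' - u in giso gorth; pose h x := x + (f x w / f u u') *: w.
have hl : linear h.
  move=> a x y; rewrite /h (pf_linl PF) mulrDl scalerDl -mulrA -scalerA.
  by rewrite [a *: (x + _)]scalerDr addrACA.
have hE := linfunE hl; set g := linfun h in hE.
have gi : lker g == 0%VS.
  apply/lker0P => x y; rewrite !hE => /eqP; rewrite -subr_eq0 => /eqP hxy.
  have fB x1 x2 z : f (x1 - x2) z = f x1 z - f x2 z.
    by rewrite formDl -scaleN1r formZl mulN1r.
  have e : (x - y) + (f (x - y) w / f u u') *: w = 0.
    by rewrite -[RHS]hxy /h fB mulrBl scalerBl opprD addrACA.
  have fww : f w w = - f u u' - f u' u.
    by rewrite /w (pf_subr PF) !fB !(pf_self PF) // sub0r subr0.
  (* Pairing with [w] leaves a nonzero multiple of [f (x - y) w]; so this vanishes, and then [e]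
     says [x - y = 0]. *)
  have := congr1 (f^~ w) e; rewrite formDl formZl form0l fww mulrBr mulrN divfK //.
  rewrite addrA subrr sub0r => /eqP; rewrite oppr_eq0 !mulf_eq0 invr_eq0.
  rewrite [f u' u == 0]formC0 (negPf uu') !orbF => /eqP fw0.
  by move: e; rewrite fw0 mul0r scale0r addr0 => /eqP; rewrite subr_eq0 => /eqP.
have gu : g u = u'.
  rewrite hE /h (_ : f u w = f u u') ?divff // ?scale1r ?subrKC //.
  by rewrite /w (pf_subr PF) (pf_self PF iu) subr0.
have gH : (g @: H)%VS = H.
  rewrite -[RHS]lim1g; apply: eq_in_limg => x xH; rewrite id_lfunE hE /h.
  have /perpP/(_ x xH)/(pf_sym PF) xu := uH; have /perpP/(_ x xH)/(pf_sym PF) xu' := uH'.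
  by rewrite /w (pf_subr PF) xu xu' subrr mul0r scale0r addr0.
exists g; last by rewrite limgD limg_line gH gu.
split=> // U /polarP[isoU oU]; apply/polarP.
split=> [_ /memv_imgP[x xU ->]|_ _ /memv_imgP[x xU ->] /memv_imgP[y yU ->]].
  by rewrite hE; apply: giso; apply: isoU.
by rewrite !hE; apply: gorth; apply: oU.
Qed.

Lemma adjacent_conj H u u' : u \notin H -> u' \notin H ->
  (H + <[u]>)%VS \in P -> (H + <[u']>)%VS \in P -> polar_conj (H + <[u]>) (H + <[u']>).
Proof.
move=> uH uH' UP UP'.
have HP : H \in P := polarS PG UP (addvSl _ _).
have inl x : x \in (H + <[x]>)%VS by rewrite memvE addvSr.
have /polarP[isoU oU] := UP; have /polarP[isoU' oU'] := UP'.
have iu := isoU u (inl u); have iu' := isoU' u' (inl u').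
have pu : u \in perp H.
  by apply/perpP=> h hH; apply: oU => //; apply: subvP (addvSl _ _) _ hH.
have pu' : u' \in perp H.
  by apply/perpP=> h hH; apply: oU' => //; apply: subvP (addvSl _ _) _ hH.
have [uu'|uu'] := eqVneq (f u u') 0; last exact: swap_conj.
have [u'U|u'U] := boolP (u' \in (H + <[u]>)%VS).
  rewrite (_ : (H + <[u']>)%VS = (H + <[u]>)%VS); first exact: polar_conj_refl.
  by apply: subv_dim_eq; rewrite ?dimv_add_line // subv_add addvSl -memvE.
have uU' : u \notin (H + <[u']>)%VS.
  apply: contra u'U => uU'; rewrite (_ : (H + <[u]>)%VS = (H + <[u']>)%VS) //.
  by apply: subv_dim_eq; rewrite ?dimv_add_line // subv_add addvSl -memvE.
have TP : (H + <[u]> + <[u']>)%VS \in P.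
  apply: polar_add_line => //; apply/perpP=> _ /memv_addP[h hH [_ /vlineP[a ->] ->]].
  apply: (pf_sym PF); have /perpP/(_ h hH)/(pf_sym PF) hu := pu'.
  by rewrite formDl formZl hu uu' mulr0 addr0.
have TP' : (H + <[u']> + <[u]>)%VS \in P by rewrite -addvA [(<[_]> + _)%VS]addvC addvA.
(* When [u] and [u'] are orthogonal, the swap goes through a third vector: [x1] is orthogonal to [u]
   but not to [u'], [x2] the reverse, so [x1 + x2] is orthogonal to neither. *)
have [x1 x1U x1u] := perp_proper u'U TP; have [x2 x2U x2u] := perp_proper uU' TP'.
have x1u0 : f x1 u = 0 by have /perpP := x1U; apply.
have x2u0 : f x2 u' = 0 by have /perpP := x2U; apply.
have xu : f (x1 + x2) u != 0 by rewrite formDl x1u0 add0r.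
have [a iw] := pf_hyper PF iu xu; set w := _ + _ in iw.
have wu : f w u != 0 by rewrite /w formDl formZl (pf_self PF iu) mulr0 addr0.
have wu' : f w u' != 0.
  by rewrite /w formDl formZl uu' mulr0 addr0 formDl x2u0 addr0.
have wH : w \in perp H.
  rewrite !rpredD ?rpredZ //; apply: subvP (perpS PG (addvSl H _)) _ _; first exact: x1U.
  exact: x2U.
apply: (@polar_conj_trans _ (H + <[w]>)%VS); apply: swap_conj => //.
by rewrite formC0.
Qed.

(** Replacing [U] by [H + <[u']>], with [u'] in [U'] outside [U] and [H] a hyperplane of [U] that
    contains [U :&: U'] and is orthogonal to [u'], enlarges the intersection with [U']. *)
Lemma polar_transitive U U' : U \in P -> U' \in P -> \dim U = \dim U' -> polar_conj U U'.
Proof.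
move=> UP UP' dUU; have [n En] := ubnP (\dim U - \dim (U :&: U'))%N.
elim: n U UP dUU En => // n IH U UP dUU En.
have [eq0|neq0] := posnP (\dim U - \dim (U :&: U'))%N.
  have -> : U = U'; last exact: polar_conj_refl.
  have e : (U :&: U')%VS = U by apply: subv_dim_eq; rewrite ?capvSl //; dlia.
  by apply: subv_dim_eq; rewrite ?dUU // -e capvSr.
have leI := dimvS (capvSl U U').
have /subvPn[u' uU' uU] : ~~ (U' <= U)%VS.
  apply/negP=> s; have : (U' <= U :&: U')%VS by rewrite subv_cap s subvv.
  by move/dimvS; dlia.
have u'P : <[u']>%VS \in P by apply: (polarS PG UP'); rewrite -memvE.
have [||H [sH1 sH2 dH]] := @subv_between _ _ (U :&: U')%VS (U :&: perp <[u']>)%VS (\dim U).-1.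
- rewrite subv_cap capvSl /=; apply: (polar_sub_perp PG UP'); first exact: capvSr.
  by rewrite -memvE.
- have := dim_cap_perp PG <[u']> U; have : (\dim <[u']> <= 1)%N by rewrite dim_vline; case: (_ != _).
  by dlia.
have sHU := subv_trans sH2 (capvSl _ _); have HP := polarS PG UP sHU.
have uH : u' \notin H by apply: contra uU; apply: subvP.
have iu' : iso u' by have /polarP[+ _] := UP'; apply.
have U1P : (H + <[u']>)%VS \in P.
  by apply: polar_add_line => //; rewrite memvE (perpC PG) (subv_trans sH2) ?capvSr.
have dU1 : \dim (H + <[u']>) = \dim U by rewrite dimv_add_line // dH; dlia.
apply: (@polar_conj_trans _ (H + <[u']>)%VS).
  have [u uH' UE] : exists2 u, u \notin H & U = (H + <[u]>)%VS.
    by apply: polar_split => //; dlia.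
  by rewrite UE; apply: adjacent_conj => //; rewrite -UE.
apply: IH => //; first by rewrite dU1.
have s : (U :&: U' + <[u']> <= (H + <[u']>) :&: U')%VS.
  rewrite subv_cap; apply/andP; split; first by apply: addvS.
  by rewrite subv_add capvSr -memvE.
have uI : u' \notin (U :&: U')%VS by rewrite memv_cap (negPf uU).
have s1 := dimvS s; rewrite dimv_add_line // in s1.
by rewrite dU1; dlia.
Qed.

End PolarSpaceForm.

(** * The classical polar spaces *)

Section SumsOfSquares.
Variables (F : finFieldType) (D : {set F}).
Hypotheses (D0 : 0 \in D)
  (DM : {in D &, forall x y, x * y \in D}) (DB : {in D &, forall x y, x - y \in D}).

Let S := [set x ^+ 2 | x in D].

Lemma card_squares_geq : (#|D| < 2 * #|S|)%N.
Proof.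
have S0 : 0 \in S by apply/imsetP; exists 0; rewrite ?expr0n.
have : (#|D :\ 0%R| <= #|S :\ 0%R| * 2)%N.
  apply: (@card_cover_leq _ _ _ _ (fun s => [set x in D | x ^+ 2 == s])) => [x|s _].
    rewrite in_setD1 => /andP[x0 xD]; exists (x ^+ 2); last by rewrite in_set xD eqxx.
    by rewrite in_setD1 expf_neq0 //; apply/imsetP; exists x.
  case: (set_0Vmem [set x in D | x ^+ 2 == s]) => [->|[r]]; first by rewrite cards0.
  rewrite in_set => /andP[_ /eqP rs].
  apply: leq_trans (_ : #|[set r; - r]| <= _)%N; last by rewrite cards2; case: (_ != _).
  apply: subset_leq_card; apply/subsetP=> x; rewrite in_set in_set2 => /andP[_].
  by rewrite -rs eqf_sqr.
by rewrite (cardsD1 0 D) (cardsD1 0 S) D0 S0 !add1n; move: #|_| #|_| => m n; lia.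
Qed.

(** Pigeonhole: two translated multiples of the set of squares each fill more than half of [D]. The
    uses have [D] the whole field for quadrics and the fixed field of [theta] for hermitian
    forms. *)
Lemma sum_squares_solvable a b c : a \in D -> b \in D -> c \in D -> a != 0 -> b != 0 ->
  exists x y, [/\ x \in D, y \in D & x ^+ 2 * a + y ^+ 2 * b + c = 0].
Proof.
move=> aD bD cD a0 b0.
have SD s : s \in S -> s \in D by case/imsetP=> x xD ->; rewrite expr2 DM.
pose S1 := [set s * a | s in S]; pose S2 := [set - c - s * b | s in S].
have c1 : #|S1| = #|S| by apply: card_imset; apply: mulIf.
have c2 : #|S2| = #|S|.
  by apply: card_imset => s s' /addrI/oppr_inj; apply: mulIf.
have sub : S1 :|: S2 \subset D.
  apply/subsetP=> x; rewrite in_setU => /orP[]/imsetP[s /SD sD ->]; first exact: DM.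
  by rewrite DB ?DM // -sub0r DB.
have : S1 :&: S2 != set0.
  apply/negP=> /eqP S12; have := cardsUI S1 S2; rewrite S12 cards0 c1 c2 addn0 => e.
  by have := card_squares_geq; rewrite mul2n -addnn -e ltnNge subset_leq_card.
case/set0Pn=> z; rewrite in_setI => /andP[/imsetP[s /imsetP[x xD ->] ->]].
case/imsetP=> s' /imsetP[y yD ->] eqz; exists x, y; split=> //.
by rewrite eqz subrK addNr.
Qed.

End SumsOfSquares.

Section HermitianForms.
Variables (F : finFieldType) (V : vectType F) (eps : bool).
Variables (theta : involutive_rmorphism F) (f : {hermitian V for eps & theta}).
Variable P : {set {vspace V}}.

Let hBl x y z : f (x - y) z = f x z - f y z. Proof. exact: linearBl. Qed.
Let hBr x y z : f z (x - y) = f z x - f z y. Proof. exact: linearBr. Qed.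
Let hDl x y z : f (x + y) z = f x z + f y z. Proof. exact: linearDl. Qed.
Let hDr x y z : f z (x + y) = f z x + f z y. Proof. exact: linearDr. Qed.
Let hZl a x z : f (a *: x) z = a * f x z. Proof. exact: linearZl_LR. Qed.
Let hZr a x z : f z (a *: x) = theta a * f z x. Proof. exact: linearZr_LR. Qed.

Lemma herm_norm_diff u u' : f u u = 0 -> f u' u' = 0 ->
  f (u' - u) (u' - u) = - f u u' - f u' u.
Proof. by move=> uu uu'; rewrite hBl !hBr uu uu' sub0r subr0 addrC. Qed.

(** The terms in [f x w * f w y] cancel because [f w w = - f u u' - f u' u]. *)
Lemma herm_swap u u' x y (w := u' - u) :
    f u u = 0 -> f u' u' = 0 -> f u u' != 0 ->
  f (x + (f x w / f u u') *: w) (y + (f y w / f u u') *: w) = f x y.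
Proof.
move=> uu uu' c0; have c0' : f u' u != 0 by rewrite herm_eq0C.
have fww := herm_norm_diff uu uu'; rewrite -/w in fww.
have th : theta (f y w / f u u') = f w y / f u' u.
  rewrite [f w y]hermC [f u' u]hermC fmorph_div -mulf_div divff ?mul1r //.
  by rewrite signr_eq0.
clearbody w; rewrite hDl !hDr !hZl !hZr th fww.
by move: (f x w) (f w y) (f u u') (f u' u) c0 c0' => A B c c' c0 c0'; field; rewrite c0 c0'.
Qed.

Lemma hermitian_space_form :
    nondegenerate f -> (forall U, (U \in P) = (U <= orthov f U)%VS) ->
    (forall p v, f p p = 0 -> f v p != 0 -> exists a, f (v + a *: p) (v + a *: p) = 0) ->
    (forall U : {vspace V}, (2 < \dim U)%N -> exists v, [/\ v \in U, f v v = 0 & v != 0]) ->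
  polar_space_form f (fun v => f v v == 0) P.
Proof.
move=> nd PE hyper aniso; split.
- by move=> v a x y; rewrite hDl hZl.
- by move=> u x y; rewrite hBr.
- by move=> u v /eqP; rewrite herm_eq0C => /eqP.
- by rewrite linear0l.
- by move=> a v /eqP vv; rewrite hZl hZr vv !mulr0.
- by move=> u v /eqP uu /eqP vv uv; rewrite hnormDd // uu vv addr0.
- by move=> v /eqP.
- move=> U; rewrite PE; split=> [/orthovP oU|[_ oU]]; last exact/orthovP.
  by split=> // u uU; rewrite oU.
- move=> v _ ov; apply/eqP; rewrite -memv0 -(eqP nd); apply/mem_orthovP => u _.
  by apply/eqP; rewrite herm_eq0C ov.
- by move=> p v /eqP pp vp; have [a va] := hyper p v pp vp; exists a; rewrite va.
- by move=> U /aniso[v [vU vv v0]]; exists v; rewrite vv eqxx.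
- move=> u u' g /eqP uu /eqP uu' c0; split=> [x /eqP xx|x y xy].
    by rewrite /g herm_swap ?xx.
  by rewrite /g herm_swap.
Qed.

End HermitianForms.

Lemma symplectic_space_form (F : finFieldType) (V : vectType F)
    (f : {skew_symmetric V}) (P : {set {vspace V}}) :
    is_psymplectic f -> (forall U, (U \in P) = (U <= orthov f U)%VS) ->
  polar_space_form f (fun v => f v v == 0) P.
Proof.
move=> [nd _ alt] PE; have ff u : f u u = 0.
  have [two|two] := boolP (2 \in [pchar F]); first exact: alt.
  have := hermC f u u; rewrite expr1 mulN1r => /eqP.
  rewrite -subr_eq0 opprK -mulr2n -mulr_natr mulf_eq0 => /orP[/eqP //|two0].
  by case/negP: two; rewrite inE.
apply: (@hermitian_space_form F V true idfun f P nd PE) => [p v _ _|U dU].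
  by exists 0; rewrite ff.
exists (vpick U); rewrite memv_pick ff vpick0; split=> //.
by apply: contraTneq dU => ->; rewrite dimv0.
Qed.

Section Unitary.
Variables (F : finFieldType) (V : vectType F).
Variables (theta : involutive_rmorphism F) (f : {hermitian_sym V for theta}).
Hypothesis theta_nid : ~ (theta =1 id).

Let hDl x y z : f (x + y) z = f x z + f y z. Proof. exact: linearDl. Qed.
Let hDr x y z : f z (x + y) = f z x + f z y. Proof. exact: linearDr. Qed.
Let hZl a x z : f (a *: x) z = a * f x z. Proof. exact: linearZl_LR. Qed.
Let hZr a x z : f z (a *: x) = theta a * f z x. Proof. exact: linearZr_LR. Qed.
Let hC x y : f x y = theta (f y x).
Proof. by rewrite [LHS]hermC expr0 mul1r. Qed.

Let tK x : theta (theta x) = x. Proof. exact: (rmorphK theta). Qed.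
Let tM x y : theta (x * y) = theta x * theta y. Proof. exact: rmorphM. Qed.
Let tD x y : theta (x + y) = theta x + theta y. Proof. exact: rmorphD. Qed.
Let tV x y : theta (x / y) = theta x / theta y. Proof. exact: fmorph_div. Qed.

Let tN x : theta (- x) = - theta x. Proof. exact: rmorphN. Qed.
Let t0 : theta 0 = 0. Proof. exact: rmorph0. Qed.

(** It suffices to rescale one element of nonzero trace: 1 in odd characteristic, any element moved
    by [theta] in characteristic 2. *)
Lemma trace_solvable c : theta c = c -> exists x, x + theta x = c.
Proof.
move=> cc; suff [y ty] : exists y, y + theta y != 0.
  exists (c / (y + theta y) * y); rewrite tM tV tD tK cc.
  by rewrite [theta y + y]addrC -mulrDr divfK.
have [e he] : exists e, theta e != e.
  apply/existsP; apply: contra_notT theta_nid => /existsPn h x.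
  by apply/eqP; have := h x; rewrite negbK.
have [two|two] := eqVneq (1 + 1 : F) 0; last by exists 1; rewrite rmorph1.
exists e; apply: contra he; rewrite addrC addr_eq0 => /eqP ->.
by rewrite -subr_eq0 -opprD oppr_eq0 -[e]mul1r -mulrDl two mul0r.
Qed.

Lemma unitary_hyperbolic p v : f p p = 0 -> f v p != 0 ->
  exists a, f (v + a *: p) (v + a *: p) = 0.
Proof.
move=> pp vp; have pv : f p v != 0 by rewrite herm_eq0C.
have [|x xE] := @trace_solvable (- f v v); first by rewrite tN -hC.
exists (x / f p v); rewrite hDl !hDr !hZl !hZr pp !mulr0 addr0 divfK //.
rewrite tV -hC divfK //.
by rewrite -addrA [theta x + x]addrC xE subrr.
Qed.

(** On three pairwise orthogonal vectors, with coefficients fixed by [theta], the form is diagonal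
    in squares over the fixed field. *)
Lemma unitary_isotropic (U : {vspace V}) : (2 < \dim U)%N ->
  exists v, [/\ v \in U, f v v = 0 & v != 0].
Proof.
move=> dU.
have pickN (W : {vspace V}) : (0 < \dim W)%N -> vpick W != 0.
  by rewrite vpick0 lt0n dimv_eq0.
pose v1 := vpick U; pose U2 := (U :&: orthov f <[v1]>)%VS; pose v2 := vpick U2.
pose U3 := (U2 :&: orthov f <[v2]>)%VS; pose v3 := vpick U3.
have dU2 : (1 < \dim U2)%N by have := leq_dim_orthov1 f v1 U; rewrite -/U2; lia.
have dU3 : (0 < \dim U3)%N by have := leq_dim_orthov1 f v2 U2; rewrite -/U3; lia.
have v1U : v1 \in U := memv_pick U.
have [v2U v21] : v2 \in U /\ f v2 v1 = 0.
  by have := memv_pick U2; rewrite memv_cap mem_orthov1 => /andP[-> /eqP].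
have [v3U v31 v32] : [/\ v3 \in U, f v3 v1 = 0 & f v3 v2 = 0].
  have := memv_pick U3; rewrite !memv_cap !mem_orthov1.
  by case/andP=> /andP[-> /eqP-> /eqP->].
have [e1|n1] := eqVneq (f v1 v1) 0; first by exists v1; split; rewrite ?pickN //; lia.
have [e2|n2] := eqVneq (f v2 v2) 0; first by exists v2; split; rewrite ?pickN //; lia.
have [e3|n3] := eqVneq (f v3 v3) 0; first by exists v3; split; rewrite ?pickN //; lia.
have sym0 x y : f x y = 0 -> f y x = 0 by move=> xy; rewrite hC xy t0.
pose D := [set x : F | theta x == x].
have fD v : f v v \in D by rewrite inE -hC.
have [|||x [y [xD yD eq0]]] := @sum_squares_solvable F D _ _ _ _ _ _ (fD v1) (fD v2) (fD v3) n1 n2.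
- by rewrite inE t0.
- by move=> x y; rewrite !inE tM => /eqP-> /eqP->.
- by move=> x y; rewrite !inE tD tN => /eqP-> /eqP->.
exists (x *: v1 + y *: v2 + v3); split.
- by rewrite !rpredD ?rpredZ.
- move: xD yD; rewrite !inE => /eqP xD /eqP yD.
  rewrite !hDl !hDr !hZl !hZr xD yD v21 v31 v32 (sym0 _ _ v21) (sym0 _ _ v31) (sym0 _ _ v32).
  by rewrite !mulr0 !addr0 !add0r !mulrA -!expr2.
apply: contraNneq n3 => v0; have := hDl (x *: v1 + y *: v2) v3 v3.
rewrite v0 hDl !hZl (sym0 _ _ v31) (sym0 _ _ v32) !mulr0 !add0r => <-.
by rewrite -(scale0r v3) hZl mul0r.
Qed.

End Unitary.

Section Quadratic.
Variables (F : finFieldType) (V : vectType F) (Q : V -> F).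
Hypothesis qQ : quadratic_form Q.
Local Notation f := (polar_form Q).

Let QZ a v : Q (a *: v) = a ^+ 2 * Q v. Proof. exact: qQ.1. Qed.
Let fPl v a x y : f (a *: x + y) v = a * f x v + f y v. Proof. exact: qQ.2.1. Qed.
Let fPr v a x y : f v (a *: x + y) = a * f v x + f v y. Proof. exact: qQ.2.2. Qed.

Let fC x y : f x y = f y x.
Proof. by rewrite /polar_form [x + y]addrC addrAC. Qed.

Let QD x y : Q (x + y) = Q x + Q y + f x y.
Proof. by rewrite /polar_form; ring. Qed.

Let f0l v : f 0 v = 0.
Proof. by have := fPl v (-1) 0 0; rewrite scaler0 addr0 mulN1r addNr. Qed.

Let fZl a x v : f (a *: x) v = a * f x v.
Proof. by have := fPl v a x 0; rewrite addr0 f0l addr0. Qed.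

Let fZr a x v : f v (a *: x) = a * f v x. Proof. by rewrite fC fZl fC. Qed.

Let fBr v x y : f v (x - y) = f v x - f v y.
Proof. by rewrite addrC -scaleN1r fPr mulN1r addrC. Qed.

Let fDl x y v : f (x + y) v = f x v + f y v.
Proof. by have := fPl v 1 x y; rewrite scale1r mul1r. Qed.

Let fxx x : f x x = 2%:R * Q x.
Proof.
rewrite /polar_form -mulr2n -scaler_nat QZ; ring.
Qed.

Let fortho u : {W : {vspace V} | forall x, (x \in W) = (f x u == 0)
  & forall U : {vspace V}, (\dim U <= (\dim (U :&: W)).+1)%N}.
Proof.
pose g : 'Hom(V, F^o) := linfun (fun x => f x u : F^o).
exists (lker g); last exact: dim_cap_lker.
by move=> x; rewrite memv_ker linfunE // => a y z; apply: fPl.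
Qed.

(** Odd characteristic follows the hermitian argument; in characteristic 2 every scalar is a square
    and two orthogonal vectors suffice. *)
Lemma quadratic_isotropic (U : {vspace V}) : (2 < \dim U)%N ->
  exists v, [/\ v \in U, Q v = 0 & v != 0].
Proof.
move=> dU.
have pickN (W : {vspace V}) : (0 < \dim W)%N -> vpick W != 0.
  by rewrite vpick0 lt0n dimv_eq0.
pose v1 := vpick U; have v1U : v1 \in U := memv_pick U.
have [W1 W1P dW1] := fortho v1; pose U2 := (U :&: W1)%VS.
have dU2 : (1 < \dim U2)%N by have := dW1 U; rewrite -/U2; lia.
have [e1|n1] := eqVneq (Q v1) 0; first by exists v1; split; rewrite ?pickN //; lia.
have [two|two] := eqVneq (2%:R : F) 0.
  have /subvPn[v2 v2U2 v21] : ~~ (U2 <= <[v1]>)%VS.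
    by apply/negP=> /dimvS; rewrite dim_vline; case: (_ != _); lia.
  have [v2U o21] : v2 \in U /\ f v2 v1 = 0.
    by move: v2U2; rewrite memv_cap W1P => /andP[-> /eqP].
  have [x xE] : exists x, x ^+ 2 = - Q v2 / Q v1.
    have inj : injective (fun x : F => x ^+ 2).
      move=> x y /eqP; rewrite eqf_sqr => /orP[/eqP //|/eqP ->].
      apply/eqP; rewrite eq_sym -subr_eq0 opprK -mulr2n -mulr_natl two mul0r //.
    have [g _ gK] := injF_bij inj; by exists (g (- Q v2 / Q v1)); rewrite gK.
  exists (x *: v1 + v2); split; first by rewrite rpredD ?rpredZ.
    by rewrite QD QZ fZl fC o21 mulr0 addr0 xE divfK // addNr.
  by apply: contraNneq v21 => /eqP; rewrite addrC addr_eq0 => /eqP ->; rewrite rpredN rpredZ ?memv_line.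
pose v2 := vpick U2.
have [W2 W2P dW2] := fortho v2; pose U3 := (U2 :&: W2)%VS; pose v3 := vpick U3.
have dU3 : (0 < \dim U3)%N by have := dW2 U2; rewrite -/U3; lia.
have [v2U v21] : v2 \in U /\ f v2 v1 = 0.
  by have := memv_pick U2; rewrite memv_cap W1P => /andP[-> /eqP].
have [v3U v31 v32] : [/\ v3 \in U, f v3 v1 = 0 & f v3 v2 = 0].
  have := memv_pick U3; rewrite !memv_cap W1P W2P.
  by case/andP=> /andP[-> /eqP-> /eqP->].
have [e2|n2] := eqVneq (Q v2) 0; first by exists v2; split; rewrite ?pickN //; lia.
have [e3|n3] := eqVneq (Q v3) 0; first by exists v3; split; rewrite ?pickN //; lia.
have [x [y [_ _ eq0]]] : exists x y, [/\ x \in [set: F], y \in [set: F]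
    & x ^+ 2 * Q v1 + y ^+ 2 * Q v2 + Q v3 = 0].
  by apply: sum_squares_solvable; rewrite ?in_setT // => x y _ _; rewrite in_setT.
exists (x *: v1 + y *: v2 + v3); split.
- by rewrite !rpredD ?rpredZ.
- rewrite !QD !QZ !fDl !fZl !fZr (fC v1) v21 (fC v1) v31 (fC v2) v32.
  by rewrite !mulr0 !addr0.
apply: contraNneq (mulf_neq0 two n3) => v0; rewrite -fxx.
have := fDl (x *: v1 + y *: v2) v3 v3; rewrite v0 fDl !fZl f0l (fC v1) v31 (fC v2) v32.
by rewrite !mulr0 !add0r => <-.
Qed.

(** Since [Q w = - f u u'], the map is the reflection in [w]. *)
Lemma quadratic_swap u u' x (w := u' - u) : Q u = 0 -> Q u' = 0 -> f u u' != 0 ->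
  Q (x + (f x w / f u u') *: w) = Q x.
Proof.
move=> uu uu' c0.
have Qw : Q w = - f u u'.
  by rewrite /w QD -scaleN1r QZ fZr uu uu' mulr0 !add0r mulN1r fC.
clearbody w; rewrite QD QZ fZr Qw.
by move: (f x w) (f u u') (Q x) c0 => A c B c0; field.
Qed.

Lemma quadratic_space_form (P : {set {vspace V}}) : nondegenerate_quadratic Q ->
    (forall U, U \in P <-> {in U, forall u, Q u = 0}) ->
  polar_space_form f (fun v => Q v == 0) P.
Proof.
move=> nd PE; split.
- by move=> v a x y; rewrite fPl.
- by move=> u x y; rewrite fBr.
- by move=> u v; rewrite fC.
- by rewrite -(scale0r 0) QZ expr0n mul0r.
- by move=> a v /eqP vv; rewrite QZ vv mulr0.
- by move=> u v /eqP uu /eqP vv uv; rewrite QD uu vv uv !addr0.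
- by move=> v /eqP vv; rewrite fxx vv mulr0.
- move=> U; rewrite PE; split=> [sU|[sU _]]; last by move=> u /sU/eqP.
  split=> [u /sU ->//|u v uU vU].
  by rewrite /polar_form !sU ?rpredD // !subr0.
- by move=> v /eqP vv ov; apply: nd.
- move=> p v /eqP pp vp; exists (- Q v / f v p); apply/eqP.
  by rewrite QD QZ pp mulr0 addr0 fZr divfK // addrN.
- by move=> U /quadratic_isotropic[v [vU vv v0]]; exists v; rewrite vv eqxx.
move=> u u' g /eqP uu /eqP uu' c0.
have Qg x : Q (g x) = Q x by apply: quadratic_swap.
have gD x y : g (x + y) = g x + g y.
  by rewrite /g fDl mulrDl scalerDl addrACA.
split=> [x /eqP xx|x y]; first by rewrite Qg xx.
by rewrite /polar_form -gD !Qg.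
Qed.

End Quadratic.

Lemma classical_space_form (F : finFieldType) (V : vectType F) (P : {set {vspace V}}) :
  classical_polar_space P -> exists f iso, @polar_space_form F V f iso P.
Proof.
case=> [f sf PE|theta f nid [nd _] PE|Q qQ nd PE].
- by exists f, (fun v => f v v == 0); apply: symplectic_space_form.
- exists f, (fun v => f v v == 0); apply: (hermitian_space_form nd PE).
    exact: unitary_hyperbolic.
  exact: unitary_isotropic.
- by exists (polar_form Q), (fun v => Q v == 0); apply: quadratic_space_form.
Qed.

(** * Isomorphic families and largest families *)

Section Automorphisms.
Variables (F : finFieldType) (V : vectType F) (P : {set {vspace V}}).
Variables (f : V -> V -> F) (iso : pred V).
Hypothesis PF : polar_space_form f iso P.
Implicit Types (U W : {vspace V}) (Y Z : {set {vspace V}}).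
Local Notation d := (polar_rank P).
Local Notation gens := (generators P).
Let PG := form_geometry PF.

Lemma linear_auto_gens (g : 'End(V)) z : polar_linear_auto P g -> z \in gens ->
  (g @: z)%VS \in gens.
Proof.
move=> [gi gP] /(generatorsP PG)[zP dz]; apply/(generatorsP PG).
by rewrite gP // limg_dim_eq // (eqP gi) capv0.
Qed.

Lemma linear_auto_gens_on (g : 'End(V)) W : polar_linear_auto P g ->
  (#|gens_on P W| <= #|gens_on P (g @: W)|)%N.
Proof.
move=> gA; have [gi _] := gA.
rewrite -(card_imset (f := fun z => (g @: z)%VS)); last first.
  by move=> z z' /eqP; rewrite eq_limg_ker0 // => /eqP.
apply: subset_leq_card; apply/subsetP=> _ /imsetP[z + ->]; rewrite !in_gens_on.
by case/andP=> zg sWz; rewrite linear_auto_gens // limgS.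
Qed.

Lemma card_gens_on_const H H' : H \in P -> H' \in P -> \dim H = \dim H' ->
  #|gens_on P H| = #|gens_on P H'|.
Proof.
move=> HP HP' dHH; apply/eqP; rewrite eqn_leq.
have [g gA gH] := polar_transitive PF HP HP' dHH.
have [h hA hH] := polar_transitive PF HP' HP (esym dHH).
by have := linear_auto_gens_on H gA; have := linear_auto_gens_on H' hA; rewrite gH hH => -> ->.
Qed.

Lemma linear_auto_gmeet (g : 'End(V)) U k : polar_linear_auto P g ->
  [set (g @: z)%VS | z in generators_meeting P U k] \subset generators_meeting P (g @: U) k.
Proof.
move=> gA; have [gi _] := gA; apply/subsetP=> _ /imsetP[z + ->]; rewrite !in_gmeet.
case/andP=> zg le; rewrite linear_auto_gens // -lker0_img_cap //.
by rewrite limg_dim_eq // (eqP gi) capv0.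
Qed.

Lemma card_gmeet_leq U U' k : U \in P -> U' \in P -> \dim U = \dim U' ->
  (#|generators_meeting P U k| <= #|generators_meeting P U' k|)%N.
Proof.
move=> UP UP' dUU; have [g gA <-] := polar_transitive PF UP UP' dUU.
apply: leq_trans (subset_leq_card (linear_auto_gmeet U k gA)).
by rewrite card_imset // => z z' /eqP; rewrite eq_limg_ker0 ?gA.1 // => /eqP.
Qed.

Lemma gmeet_isomorphic U U' k : U \in P -> U' \in P -> \dim U = \dim U' ->
  isomorphic_in P (generators_meeting P U k) (generators_meeting P U' k).
Proof.
move=> UP UP' dUU; have [g gA gU] := polar_transitive PF UP UP' dUU.
have [gi gP] := gA; exists (fun W => (g @: W)%VS).
have inj : injective (fun W => (g @: W)%VS).
  by move=> z z' /eqP; rewrite eq_limg_ker0 // => /eqP.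
split; [split | ].
- apply/eqP; rewrite eqEcard card_imset // leqnn andbT.
  by apply/subsetP=> _ /imsetP[W WP ->]; apply: gP.
- by move=> W W' _ _; rewrite limg_ker0.
apply/eqP; rewrite eqEcard -{1}gU linear_auto_gmeet // card_imset //.
by rewrite card_gmeet_leq.
Qed.

(** [phi] is only an order automorphism, but it maps a chain of subspaces below [U] to a strict
    chain. *)
Lemma polar_automorphism_dim (phi : {vspace V} -> {vspace V}) U :
  polar_automorphism P phi -> U \in P -> (\dim U <= \dim (phi U))%N.
Proof.
move=> [phiP phiS]; move En: (\dim U) => n; elim: n U En => // n IH U dU UP.
have [|H [_ sHU dH]] := @subv_between _ _ 0%VS U n (sub0v _); first by rewrite dimv0 dU /=.
have HP := polarS PG UP sHU.
apply: leq_ltn_trans (IH _ dH HP) _; rewrite ltnNge; apply/negP=> le.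
have := phiS H U HP UP; rewrite sHU => sphi.
have := phiS U H UP HP; rewrite -(subv_dim_eq sphi le) subvv.
by move=> /esym/dimvS; rewrite dU dH ltnn.
Qed.

Lemma isomorphic_EKR t Y Z : EKR_set P d t Y -> isomorphic_in P Y Z ->
  EKR_set P d t Z /\ #|Z| = #|Y|.
Proof.
move=> [sY Yt] [phi [phiA <-]]; have [phiP phiS] := phiA.
have YP y : y \in Y -> y \in P by move/(subsetP sY)/(gen_polar PG).
have inP U : U \in P -> phi U \in P by move=> UP; rewrite -phiP imset_f.
have inj : {in P &, injective phi}.
  move=> U W UP WP eqf; apply/eqP; rewrite eqEsubv -(phiS U W) // -(phiS W U) //.
  by rewrite eqf subvv.
split; last by rewrite card_in_imset // => y y' /YP yP /YP; apply: inj.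
split.
  apply/subsetP=> _ /imsetP[y yY ->]; have yP := YP y yY.
  rewrite (generators_dim PG) inP //= eqn_leq (polar_dim_leq (inP y yP)) /=.
  have /(generatorsP PG)[_ <-] := subsetP sY y yY.
  exact: polar_automorphism_dim.
move=> _ _ /imsetP[y yY ->] /imsetP[y' yY' ->]; apply: leq_trans (Yt _ _ yY yY').
have IP : (y :&: y')%VS \in P by apply: (polarS PG (YP y yY)); apply: capvSl.
apply: leq_sub2l; apply: leq_trans (polar_automorphism_dim phiA IP) _; apply: dimvS.
by rewrite subv_cap; apply/andP; split; rewrite phiS ?capvSl ?capvSr //; apply: YP.
Qed.

Lemma gmeet_EKR t U : U \in P -> \dim U = (d - odd t)%N -> (t < d)%N ->
  EKR_set P d t (generators_meeting P U (d - t.+1./2)).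
Proof.
move=> UP dU td; split; first by apply/subsetP=> z; rewrite in_gmeet => /andP[].
move=> y y'; rewrite !in_gmeet => /andP[yg le] /andP[yg' le'].
have s1 : ((y :&: U) :&: (y' :&: U) <= y :&: y')%VS by apply: capvS; apply: capvSl.
have s2 : ((y :&: U) + (y' :&: U) <= U)%VS by rewrite subv_add !capvSr.
have := dimvS s1; have := dimvS s2; have := dimv_sum_cap (y :&: U) (y' :&: U).
have := odd_double_half t; move: le le' dU td; case: (odd t); clear; lia.
Qed.

Lemma EKR_setW t Y : EKR_set P d t Y ->
  {in Y &, forall y1 y2, (d - t <= \dim (y1 :&: y2))%N}.
Proof. by move=> [_ Yt] y1 y2 yY yY'; have := Yt y1 y2 yY yY'; clear; lia. Qed.

(** The example of [EKR_bound] is itself an EKR set, so a largest [Y] cannot be smaller and the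
    inclusion is an equality. *)
Lemma largest_EKR_sub t kp Y : const_absorbed F kp -> large_rank t kp d ->
    largest_EKR_set P d t Y ->
  exists U, [/\ U \in P, \dim U = (d - odd t)%N & Y = generators_meeting P U (d - t.+1./2)].
Proof.
move=> kpP big_d [YE Ymax].
have td : (t < d)%N by have := large_rankE big_d; clear; nia.
have d0 : (0 < d)%N by apply: leq_trans td.
have [U0 U0g] := has_gen PG; have U0P := gen_polar PG U0g; have dU0 := gen_dim PG U0g.
have [|H [_ sH dH]] := @subv_between _ _ 0%VS U0 d.-1 (sub0v _); first by rewrite dimv0 dU0 leq_pred.
have HP := polarS PG U0P sH; have dH' : (\dim H).+1 = d by rewrite dH prednK.
pose E := #|gens_on P H|.-1.
have gt1 := card_gens_on_gt1 PF HP dH'; have le3 := card_gens_on_leq PF HP dH'.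
have EE : #|gens_on P H| = E.+1 by rewrite /E prednK // ltnW.
have cE H' : H' \in P -> (\dim H').+1 = d -> #|gens_on P H'| = E.+1.
  move=> HP'; rewrite -dH' => -[dHH].
  by rewrite (card_gens_on_const HP' HP).
have E0 : (0 < E)%N by move: gt1; rewrite EE.
have E3 : few_gens F E by rewrite /few_gens; move: le3; rewrite EE.
have Y0 : Y != set0.
  rewrite -card_gt0; apply: leq_trans (Ymax [set U0] _); first by rewrite cards1.
  split; first by rewrite sub1set.
  by move=> y1 y2 /set1P -> /set1P ->; rewrite capvv dU0 subnn.
have [U [UP dU YU]] := EKR_bound PG cE E0 E3 kpP big_d YE.1 (EKR_setW YE) Y0.
exists U; split=> //; have maxU := Ymax _ (gmeet_EKR UP dU td).
case: YU => [sYU|]; last by rewrite ltnNge maxU.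
by apply/eqP; rewrite eqEcard sYU.
Qed.

Lemma largest_EKR_iff t kp U Y : const_absorbed F kp -> large_rank t kp d ->
    U \in P -> \dim U = (d - odd t)%N ->
  largest_EKR_set P d t Y <-> isomorphic_in P (generators_meeting P U (d - t.+1./2)) Y.
Proof.
move=> kpP big_d UP dU; have td : (t < d)%N by have := large_rankE big_d; clear; nia.
split=> [/(largest_EKR_sub kpP big_d)[U' [UP' dU' ->]]|isoY].
  by apply: gmeet_isomorphic => //; rewrite dU.
have [YE cY] := isomorphic_EKR (gmeet_EKR UP dU td) isoY.
split=> // Z ZE; rewrite cY.
(* A largest family [M] exists by finiteness and is an example on some [U']; by transitivity the
   example on [U] has the same size. *)
have [M ME Mmax] : exists2 M : {set {vspace V}}, EKR_set P d t M
    & forall Z, EKR_set P d t Z -> (#|Z| <= #|M|)%N.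
  pose ekrb (M : {set {vspace V}}) := (M \subset gens) &&
    [forall y1 in M, [forall y2 in M, (d - \dim (y1 :&: y2)%VS <= t)%N]].
  have ekrP M : reflect (EKR_set P d t M) (ekrb M).
    apply: (iffP andP) => -[sM Mt]; split=> //.
      by move=> y1 y2 y1M y2M; have /forall_inP/(_ _ y1M)/forall_inP := Mt; apply.
    by apply/forall_inP=> y1 y1M; apply/forall_inP=> y2 y2M; apply: Mt.
  case: (@arg_maxnP _ Z ekrb (fun M => #|M|)); first exact/ekrP.
  by move=> M /ekrP ME Mmax; exists M => // Z' /ekrP; apply: Mmax.
have [U' [UP' dU' MU]] := largest_EKR_sub kpP big_d (conj ME Mmax).
apply: leq_trans (Mmax _ ZE) _; rewrite MU card_gmeet_leq //.
by rewrite dU dU'.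
Qed.

End Automorphisms.

Lemma const_absorbed2 (F : finFieldType) : #|F| = 2%N -> const_absorbed F 13.
Proof. by rewrite /const_absorbed /qconst => ->. Qed.

Lemma const_absorbed3 (F : finFieldType) : (2 < #|F|)%N -> const_absorbed F 5.
Proof.
move=> q3; rewrite /const_absorbed /qconst ifN; last by rewrite gtn_eqF.
by apply: (@leq_trans (3 ^ 5)); rewrite // leq_exp2r.
Qed.

Lemma sqrt_bound (R : rcfType) (a b t d : nat) : (0 < b)%N ->
  t%:R <= Num.sqrt (a%:R * d%:R / b%:R) - 2%:R :> R -> (b * (t + 2) ^ 2 <= a * d)%N.
Proof.
move=> b0; rewrite lerBrDr -natrD => le.
have x0 : (0 : R) <= a%:R * d%:R / b%:R by rewrite divr_ge0 ?mulr_ge0 ?ler0n.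
have : ((t + 2)%:R ^+ 2 : R) <= a%:R * d%:R / b%:R.
  by rewrite -(sqr_sqrtr x0) lerXn2r ?nnegrE ?ler0n ?sqrtr_ge0.
by rewrite ler_pdivlMr ?ltr0n // -natrX -!natrM ler_nat mulnC.
Qed.

Theorem theorem1p3 (R : rcfType) (q t d : nat)
  (hi : q = 2%N -> t%:R <= Num.sqrt (8%:R * d%:R / 9%:R) - 2%:R :> R)
  (hii : (3 <= q)%N -> t%:R <= Num.sqrt (8%:R * d%:R / 5%:R) - 2%:R :> R)
  (F : finFieldType) (hq : #|F| = q) (V : vectType F)
  (P : {set {vspace V}}) (hP : classical_polar_space P)
  (hd : polar_rank P = d) :
  (~~ odd t ->
     forall U : {vspace V}, U \in P -> \dim U = d ->
     forall Y : {set {vspace V}},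
       largest_EKR_set P d t Y <->
       isomorphic_in P (generators_meeting P U (d - t./2)) Y) /\
  (odd t ->
     forall U : {vspace V}, U \in P -> \dim U = d.-1 ->
     forall Y : {set {vspace V}},
       largest_EKR_set P d t Y <->
       isomorphic_in P (generators_meeting P U (d - (t.+1)./2)) Y).
Proof.
have [f [iso PF]] := classical_space_form hP.
have [kp [kpP big_d]] : exists kp, const_absorbed F kp /\ large_rank t kp d.
  have : (1 < q)%N by rewrite -hq card_finNzRing_gt1.
  rewrite leq_eqVlt => /orP[/eqP q2|q3].
    exists 13; split; first by apply: const_absorbed2; rewrite hq.
    by left; split=> //; apply: (sqrt_bound (R := R)) => //; apply: hi.
  exists 5; split; first by apply: const_absorbed3; rewrite hq.
  by right; split=> //; apply: (sqrt_bound (R := R)) => //; apply: hii.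
move: big_d; rewrite -hd => big_d; split=> [even_t|odd_t] U UP dU Y.
  (* For even [t] the two halves agree, which reduces to the form common to both parities. *)
  have -> : t./2 = t.+1./2.
    by have := odd_double_half t; rewrite (negPf even_t); clear; lia.
  by apply: (largest_EKR_iff PF _ kpP big_d UP); rewrite (negPf even_t) subn0.
by apply: (largest_EKR_iff PF _ kpP big_d UP); rewrite odd_t subn1.
Qed.
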